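(* Let $T$ be an essentially locally compact m-tower. For every (closed two-sided) ideal $J$ in $C^*_0(T)$ there exists a unique subtower $S$ of $T$ such that $S\supset T_{(0)}$ and $J$ coincides with the ideal $J_S$ of all $f\in C^*_0(T)$ that vanish at each point of $S$.
   Context: Conventions. All topological spaces are Hausdorff; $\mathbb N=\{1,2,\ldots\}$. $M_n$ is the $C^*$-algebra of complex $n\times n$ matrices, $\mathcal U_n$ its unitary group, $I_n$ its unit. For $U\in\mathcal U_n$, $X\in M_n$: $U.X=UXU^{-1}$. For $X\in M_n$, $Y\in M_k$, $X\oplus Y\in M_{n+k}$ is the block-diagonal matrix. Towers. A tower is a topological space $T$ with a continuous function $d\colon T\to\mathbb N$, an operation $\oplus\colon T\times T\to T$ and functions $\mathcal U_n\times T_n\ni(U,x)\mapsto U.x\in T$ (where $T_n=d^{-1}(\{n\})$), such that: (T1) $\oplus$ is associative and continuous, and for each $n$ the map $T_n\times T\ni(x,y)\mapsto x\oplus y\in T$ is a closed embedding; (T2) $d(x\oplus y)=d(x)+d(y)$ and $d(U.x)=d(x)$; (T3) each $\mathcal U_n\times T_n\to T_n$ is a continuous group action; (T4) $U.x=x$ if $U\in\mathcal U_{d(x)}$ is a scalar multiple of the unit matrix; (T5) $(U\oplus V).(x\oplus y)=(U.x)\oplus(V.y)$ for $x\in T_n$, $y\in T_k$, $U\in\mathcal U_n$, $V\in\mathcal U_k$; (T6) $U_{d(x),d(y)}.(x\oplus y)=y\oplus x$, where $U_{p,q}\in\mathcal U_{p+q}$ is given by $(w_1,\ldots,w_q,z_1,\ldots,z_p)\cdot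 U_{p,q}=(z_1,\ldots,z_p,w_1,\ldots,w_q)$ (row vectors). Let $T$ be a tower. An element $x$ is reducible if $V.x=a\oplus b$ for some $a,b\in T$, $V\in\mathcal U_{d(x)}$; otherwise it is irreducible. $\operatorname{stab}(x)=\{U\in\mathcal U_{d(x)}: U.x=x\}$. $x\equiv y$ means $U.x=y$ for some $U\in\mathcal U_{d(x)}$; $x\preccurlyeq y$ means that $x\equiv y$ or there are $a,b\in T$ with $x\equiv a$, $y\equiv a\oplus b$; $x\perp y$ ($x,y$ disjoint) means there is no $a\in T$ with $a\preccurlyeq x$ and $a\preccurlyeq y$. $\operatorname{core}(T)$ is the set of irreducible elements and $\overline{\operatorname{core}}(T)$ is its closure in $T$. A subtower of $T$ is a (possibly empty) closed subset $S\subset T$ such that $U.x\in S$ for all $x\in S$, $U\in\mathcal U_{d(x)}$, and for all $x,y\in T$: $x\oplus y\in S$ iff $x\in S$ and $y\in S$. A topological space $X$ has property $(\sigma)$ if there are sets $K_1\subset K_2\subset\cdots$ with union $X$, each compact Hausdorff in the subspace topology, such that $B\subset X$ is closed iff $B\cap K_n$ is closed for each $n$. An m-tower is a tower $T$ that has property $(\sigma)$ and satisfies for all $x,y,z\in T$: (mT1) if $z\perp x$ and $z\perp y$, then $z\perp x\oplus y$; (mT2) if $z\oplus x\equiv z\oplus y$, then $x\equiv y$; (mT3) if $x\perp y$, then $\operatorname{stab}(x\oplus y)=\{U\oplus V: U\in\operatorname{stab}(x),\ V\in\operatorname{stab}(y)\}$; (mT4) if $x$ is irreducible and $p=d(x)$,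 then for each $n>0$ the stabilizer of the $n$-fold sum $x\oplus\cdots\oplus x$ is $\{I_p\otimes U: U\in\mathcal U_n\}$, where $I_p\otimes[u_{jk}]$ is the block matrix $[u_{jk}I_p]$. $C^*(T)$ is the unital $C^*$-algebra (pointwise operations, supremum norm) of all functions $f$ on $T$ with $f(x)\in M_{d(x)}$, $f|_{T_n}\colon T_n\to M_n$ continuous for all $n$, $f(U.x)=U.f(x)$ for $U\in\mathcal U_{d(x)}$, $f(x\oplus y)=f(x)\oplus f(y)$, and $\|f\|=\sup_{x\in T}\|f(x)\|<\infty$. An m-tower $T$ is essentially locally compact if the space $\overline{\operatorname{core}}(T)$ is locally compact. Then $C^*_0(T)$ is the $*$-subalgebra of all $f\in C^*(T)$ such that for each $\varepsilon>0$ there is a compact $K\subset\overline{\operatorname{core}}(T)$ with $\|f(t)\|\le\varepsilon$ for all $t\in\overline{\operatorname{core}}(T)\setminus K$. The vanishing tower is $T_{(0)}=\{t\in T: f(t)=0 \text{ for all } f\in C^*_0(T)\}$. *)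

(* Defs.v *)
From HB Require Import structures.
From mathcomp Require Import all_boot all_order all_algebra.
From mathcomp Require Import all_classical all_reals all_analysis.
From mathcomp Require Import complex mxtens.

Set Implicit Arguments.
Unset Strict Implicit.
Unset Printing Implicit Defensive.

Import Order.TTheory GRing.Theory Num.Theory.
Import numFieldNormedType.Exports.

Local Open Scope classical_set_scope.
Local Open Scope ring_scope.

(* Packing R[i] as a numClosedFieldType gives it, and matrices over it, the
   topology that MathComp-Analysis puts on every numClosedFieldType. *)
Definition Cplx (R : realType) : numClosedFieldType := R[i].

Section Matrices.
Variable R : realType.
Local Notation C := (Cplx R).

Definition mxdsum (n k : nat) (A : 'M[C]_n) (B : 'M[C]_k) : 'M[C]_(n + k) :=
  block_mx A 0 0 B.

(* The matrix U_{p,q}; see mul_row_swapmx. *)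
Definition swapmx (p q : nat) : 'M[C]_(p + q) :=
  castmx (addnC q p, erefl)
    (block_mx 0 1%:M 1%:M 0 : 'M[C]_(q + p, p + q)).

Lemma mul_row_swapmx (p q : nat) (w : 'rV[C]_q) (z : 'rV[C]_p) :
  castmx (erefl, addnC q p) (row_mx w z) *m swapmx p q = row_mx z w.
Proof.
have -> : row_mx z w = row_mx w z *m block_mx 0 1%:M 1%:M 0.
  by rewrite mul_row_block !mulmx0 !mulmx1 addr0 add0r.
rewrite /swapmx; set B := block_mx _ _ _ _; move: (row_mx w z) B.
by case: _ / (addnC q p) => A B; rewrite !castmx_id.
Qed.

(* Norms are R-valued, hence normc rather than the C-valued `|_|. *)
Definition l2norm (n : nat) (v : 'cV[C]_n) : R :=
  Num.sqrt (\sum_(i < n) (Normc.normc (v i 0)) ^+ 2).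

Definition opnorm (n : nat) (A : 'M[C]_n) : R :=
  sup [set l2norm (A *m v) | v in [set v : 'cV[C]_n | l2norm v <= 1]].

End Matrices.

Definition closed_embedding (X Y : topologicalType) (A : set X) (f : X -> Y) :=
  [/\ {within A, continuous f},
      set_inj A f &
      forall D : set X, closed D -> closed (f @` (A `&` D))].

(* tact n U x is U.x; it is meaningful only for U unitary and tdim x = n, and
   every axiom and definition below uses it only there. *)
Record tower (R : realType) := Tower {
  tspace :> topologicalType;
  tdim : tspace -> nat;
  tsum : tspace -> tspace -> tspace;
  tact : forall n : nat, 'M[Cplx R]_n -> tspace -> tspace;
  tower_hausdorff : hausdorff_space tspace;
  tdim_gt0 : forall x, (0 < tdim x)%N;
  tdim_continuous : continuous tdim;
  tsumA : associative tsum;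
  tsum_continuous : continuous (fun z : tspace * tspace => tsum z.1 z.2);
  tsum_closed_embedding : forall n : nat,
    closed_embedding [set z : tspace * tspace | tdim z.1 = n]
      (fun z => tsum z.1 z.2);
  tdim_sum : forall x y, tdim (tsum x y) = (tdim x + tdim y)%N;
  tdim_act : forall (n : nat) (U : 'M[Cplx R]_n) x,
    U \is unitarymx -> tdim x = n -> tdim (tact U x) = n;
  tact_continuous : forall n : nat,
    {within [set z : 'M[Cplx R]_n * tspace | z.1 \is unitarymx /\ tdim z.2 = n],
      continuous (fun z => tact z.1 z.2)};
  tact1 : forall (n : nat) x, tdim x = n -> tact (1%:M : 'M[Cplx R]_n) x = x;
  tactM : forall (n : nat) (U V : 'M[Cplx R]_n) x,
    U \is unitarymx -> V \is unitarymx -> tdim x = n ->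
    tact (U *m V) x = tact U (tact V x);
  tact_scalar : forall (n : nat) (c : Cplx R) x,
    (c%:M : 'M[Cplx R]_n) \is unitarymx -> tdim x = n ->
    tact (c%:M : 'M[Cplx R]_n) x = x;
  tact_sum : forall (n k : nat) (U : 'M[Cplx R]_n) (V : 'M[Cplx R]_k) x y,
    U \is unitarymx -> V \is unitarymx -> tdim x = n -> tdim y = k ->
    tact (mxdsum U V) (tsum x y) = tsum (tact U x) (tact V y);
  tact_swap : forall x y,
    tact (swapmx R (tdim x) (tdim y)) (tsum x y) = tsum y x
}.

Section TowerTheory.
Variables (R : realType) (T : tower R).
Local Notation C := (Cplx R).
Implicit Types (x y z a b : T).

Definition treducible x :=
  exists (V : 'M[C]_(tdim x)) (a b : T),
    V \is unitarymx /\ tact V x = tsum a b.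

Definition tirreducible x := ~ treducible x.

(* The stabilizer as a set of n x n matrices, to be used with n = tdim x: the
   size is a parameter because tdim (tsum x y) and tdim x + tdim y are only
   propositionally equal. *)
Definition stab (n : nat) x : set 'M[C]_n :=
  [set U | U \is unitarymx /\ tact U x = x].

Definition tequiv x y :=
  exists U : 'M[C]_(tdim x), U \is unitarymx /\ tact U x = y.

Definition tle x y :=
  tequiv x y \/ exists a b : T, tequiv x a /\ tequiv y (tsum a b).

Definition tdisjoint x y := ~ exists a : T, tle a x /\ tle a y.

Definition core : set T := [set x | tirreducible x].

Definition core_closure : set T := closure core.

Definition nfold (n : nat) x : T := iter n.-1 (tsum x) x.

Definition subtower (S : set T) :=
  [/\ closed S,
      forall x (U : 'M[C]_(tdim x)), S x -> U \is unitarymx -> S (tact U x) &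
      forall x y, S (tsum x y) <-> S x /\ S y].

End TowerTheory.

Arguments stab {R T} n x.
Arguments core_closure {R} T.

Definition property_sigma (X : topologicalType) :=
  exists K : nat -> set X,
    [/\ forall n, K n `<=` K n.+1,
        \bigcup_n K n = setT,
        forall n, compact (K n) /\ hausdorff_space (subspace (K n)) &
        forall B : set X, closed B <-> forall n, closed (B `&` K n)].

Record m_tower (R : realType) (T : tower R) : Prop := MTower {
  mtower_sigma : property_sigma T;
  mtower_disjoint_sum : forall x y z : T,
    tdisjoint z x -> tdisjoint z y -> tdisjoint z (tsum x y);
  mtower_cancel : forall x y z : T,
    tequiv (tsum z x) (tsum z y) -> tequiv x y;
  mtower_stab_disjoint : forall x y : T, tdisjoint x y ->
    stab (tdim x + tdim y)%N (tsum x y) =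
    [set W | exists U V,
       [/\ stab (tdim x) x U, stab (tdim y) y V & W = mxdsum U V]];
  (* U *t 1%:M is the block matrix [u_jk I_p] *)
  mtower_stab_nfold : forall (x : T) (n : nat),
    tirreducible x -> (0 < n)%N ->
    stab (n * tdim x)%N (nfold n x) =
    [set tensmx U (1%:M : 'M[Cplx R]_(tdim x))
      | U in [set U : 'M[Cplx R]_n | U \is unitarymx]]
}.

(* Points outside a set A are isolated in subspace A, so this says exactly that
   core_closure T is a locally compact space. *)
Definition essentially_locally_compact (R : realType) (T : tower R) :=
  locally_compact [set: subspace (core_closure T)].

Section Algebras.
Variables (R : realType) (T : tower R).
Local Notation C := (Cplx R).

Definition mxfield := forall x : T, 'M[C]_(tdim x).
Implicit Types f g : mxfield.

(* conform_mx 0 A is A itself when the sizes agree (conform_mx_id), which is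
   the case at every use below; it spares the casts along tdim_act, tdim_sum. *)

Definition fiber_continuous f := forall n : nat,
  {within [set x : T | tdim x = n],
    continuous (fun x => conform_mx (0 : 'M[C]_n) (f x))}.

Definition fequivariant f := forall (x : T) (U : 'M[C]_(tdim x)),
  U \is unitarymx ->
  conform_mx (0 : 'M[C]_(tdim x)) (f (tact U x)) = U *m f x *m invmx U.

Definition fadditive f := forall x y : T,
  conform_mx (0 : 'M[C]_(tdim x + tdim y)) (f (tsum x y)) = mxdsum (f x) (f y).

Definition fnorm f : R := sup [set opnorm (f x) | x in [set: T]].

Definition fbounded f := has_ubound [set opnorm (f x) | x in [set: T]].

Definition Cstar : set mxfield :=
  [set f | [/\ fiber_continuous f, fequivariant f, fadditive f & fbounded f]].

Definition Cstar0 : set mxfield :=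
  [set f | Cstar f /\
    forall e : R, 0 < e ->
      exists K : set T, [/\ compact K, K `<=` core_closure T &
        forall t, (core_closure T `\` K) t -> opnorm (f t) <= e]].

Definition vanishing_tower : set T :=
  [set t | forall f, Cstar0 f -> f t = 0].

Record closed_ideal (J : set mxfield) : Prop := ClosedIdeal {
  ideal_sub : J `<=` Cstar0;
  ideal0 : J (fun x => 0);
  idealD : forall f g, J f -> J g -> J (fun x => f x + g x);
  idealZ : forall (c : C) f, J f -> J (fun x => c *: f x);
  idealMl : forall g f, Cstar0 g -> J f -> J (fun x => g x *m f x);
  idealMr : forall f g, J f -> Cstar0 g -> J (fun x => f x *m g x);
  ideal_closed : forall f, Cstar0 f ->
    (forall e : R, 0 < e -> exists2 g, J g & fnorm (fun x => f x - g x) < e) ->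
    J f
}.

Definition ideal_of (S : set T) : set mxfield :=
  [set f | Cstar0 f /\ forall x, S x -> f x = 0].

End Algebras.

Arguments vanishing_tower {R} T.

(* Main.v *)
(* An element of [T] is a direct sum of irreducible ones, uniquely up to unitary
   equivalence, and the stabilizers are known; hence every equivariant matrix
   field on the irreducible points extends uniquely to an additive equivariant
   field on [T].  To make the extension continuous, build it by induction on the
   dimension: on the closed set of reducible points of dimension n it is already
   determined, and it is extended from there by Tietze's theorem, made
   equivariant by replacing the value at x by the Chebyshev centre (for the
   Frobenius norm) of its conjugates along the unitary orbit of x, a substitute
   for averaging over the Haar measure.  This yields bounded fields vanishing on
   a given subtower with a prescribed value at an irreducible point outside of
   it.  Multiplying a function of C*_0(T) by such fields separates subtowers
   above the vanishing tower, which gives uniqueness.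

   For existence take for S the common zero set of J.  If f in C*_0(T) vanishes
   on S, interpolation at the irreducible components of t shows that f(t) = g(t)
   for some g in J.  By compactness finitely many g_i in J approximate f off a
   set where f is small; with a = (1/c) sum_i g_i^* g_i, 0 <= a <= 1, the function
   f (1 - a)^m is uniformly small for large m, while f - f (1 - a)^m is in J. *)
From HB Require Import structures.
From mathcomp Require Import all_boot all_order all_algebra.
From mathcomp Require Import all_classical all_reals all_analysis.
From mathcomp Require Import complex mxtens.
From mathcomp Require Import ring lra zify.
Require Import Defs.

Set Implicit Arguments.
Unset Strict Implicit.
Unset Printing Implicit Defensive.

Import Order.TTheory GRing.Theory Num.Theory.
Import numFieldNormedType.Exports.

Local Open Scope classical_set_scope.
Local Open Scope ring_scope.
Local Open Scope sesquilinear_scope.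

(** * Matrices of arbitrary size *)

Section SizedMatrices.
Variable R : realType.
Local Notation C := (Cplx R).

(** The axioms (mT1)-(mT4) serve one purpose, the single-valuedness of the extension. (mT1) makes
    irreducible elements behave like primes, (mT2) cancels a common summand, and (mT3), (mT4) show
    that the stabilizer of a point commutes with every value assembled from its irreducible parts.
    Continuity is the main obstacle. Normality is available on the compact pieces of property
    (sigma), so Tietze's theorem is applied on one piece after another. The Frobenius norm is both
    Euclidean and invariant under unitary conjugation: the parallelogram law makes the centre
    unique, hence equivariant, and stable under small changes, hence continuous. The fields so
    obtained are bounded but need not decay, so they act on C*_0(T) only as multipliers. Where the
    ideal property asks for factors in C*_0(T), an element j of J is flanked by copies of its
    adjoint. The decay of g_i (1 - a)^m follows from an energy inequality for the orbit of a vector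
    under 1 - a, in place of functional calculus. Norm bounds are verified at irreducible points
    alone, where the decay condition of C*_0(T) applies, and spread from there to all of T. *)

Lemma mxdsumM n k (A B : 'M[C]_n) (A' B' : 'M[C]_k) :
  mxdsum A A' *m mxdsum B B' = mxdsum (A *m B) (A' *m B').
Proof. by rewrite /mxdsum mulmx_block !(mulmx0, mul0mx, addr0, add0r). Qed.

Lemma mxdsumD n k (A B : 'M[C]_n) (A' B' : 'M[C]_k) :
  mxdsum A A' + mxdsum B B' = mxdsum (A + B) (A' + B').
Proof. by rewrite /mxdsum add_block_mx !addr0. Qed.

Lemma mxdsumZ n k c (A : 'M[C]_n) (B : 'M[C]_k) :
  c *: mxdsum A B = mxdsum (c *: A) (c *: B).
Proof. by rewrite /mxdsum scale_block_mx !scaler0. Qed.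

Lemma mxdsum_adj n k (A : 'M[C]_n) (B : 'M[C]_k) :
  (mxdsum A B)^t* = mxdsum (A^t*) (B^t*).
Proof. by rewrite /mxdsum tr_block_mx map_block_mx !trmx0 !map_mx0. Qed.

Lemma mxdsum1 n k : mxdsum (1%:M : 'M[C]_n) (1%:M : 'M[C]_k) = 1%:M.
Proof. by rewrite /mxdsum -scalar_mx_block. Qed.

Lemma mxdsum0 n k : mxdsum (0 : 'M[C]_n) (0 : 'M[C]_k) = 0.
Proof. by rewrite /mxdsum block_mx0. Qed.

Lemma unitarymx1 n : (1%:M : 'M[C]_n) \is unitarymx.
Proof. by apply/unitarymxP; rewrite trmx1 map_mx1 mulmx1. Qed.

Lemma mxdsum_unitary n k (U : 'M[C]_n) (V : 'M[C]_k) :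
  U \is unitarymx -> V \is unitarymx -> mxdsum U V \is unitarymx.
Proof.
move=> /unitarymxP hU /unitarymxP hV; apply/unitarymxP.
by rewrite mxdsum_adj mxdsumM hU hV mxdsum1.
Qed.

Lemma adjM n m k (A : 'M[C]_(n, m)) (B : 'M[C]_(m, k)) :
  (A *m B)^t* = B^t* *m A^t*.
Proof. by rewrite trmx_mul map_mxM. Qed.

Lemma unitary_adjM n (U : 'M[C]_n) : U \is unitarymx -> U^t* *m U = 1%:M.
Proof. by move=> hU; rewrite -invmx_unitary// mulVmx// unitarymx_unit. Qed.

Lemma unitary_Madj n (U : 'M[C]_n) : U \is unitarymx -> U *m U^t* = 1%:M.
Proof. by move=> /unitarymxP. Qed.

Lemma adj_unitary n (U : 'M[C]_n) : U \is unitarymx -> U^t* \is unitarymx.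
Proof. by rewrite trmxC_unitary. Qed.

(** The type of [f (tsum x y)] matches a block sum only up to a propositional equality of
    dimensions. Packing the size with the matrix turns such identities into plain equalities; [mxof]
    returns to a fixed size, with default 0 on a mismatch. *)
Definition smx := {n : nat & 'M[C]_n}.
Definition Smx n (A : 'M[C]_n) : smx := existT (fun n => 'M[C]_n) n A.
Definition mxof n (s : smx) : 'M[C]_n := conform_mx 0 (projT2 s).
Definition smx_dsum (s t : smx) : smx := Smx (mxdsum (projT2 s) (projT2 t)).

Lemma mxof_Smx n (A : 'M[C]_n) : mxof n (Smx A) = A.
Proof. exact: conform_mx_id. Qed.

Lemma Smx_mxof n (s : smx) : projT1 s = n -> Smx (mxof n s) = s.
Proof. by case: s => m A /= <-; rewrite -/(Smx A) mxof_Smx. Qed.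

Lemma Smx_inj n : injective (@Smx n).
Proof. by move=> A B /(congr1 (mxof n)); rewrite !mxof_Smx. Qed.

Lemma Smx_conform n m (A : 'M[C]_m) :
  m = n -> Smx (conform_mx (0 : 'M[C]_n) A) = Smx A.
Proof. by move=> e; case: _ / e; rewrite conform_mx_id. Qed.

Lemma Smx_castmx n m (e : m = n) (A : 'M[C]_m) : Smx (castmx (e, e) A) = Smx A.
Proof. by case: _ / e; rewrite castmx_id. Qed.

Lemma smx_dsumA : associative smx_dsum.
Proof.
move=> [n A] [m B] [k D]; rewrite /smx_dsum /= /mxdsum.
(* The off-diagonal zeros are split into the 3 by 3 shape that [block_mxA] expects. *)
rewrite -[X in block_mx A X]row_mx0 -[X in block_mx A _ X]col_mx0.
rewrite block_mxA /= col_mx0 row_mx0.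
by rewrite Smx_castmx.
Qed.

Let xchg p q : 'M[C]_(q + p, p + q) := block_mx 0 1%:M 1%:M 0.

Lemma swapmx_unitary p q : swapmx R p q \is unitarymx.
Proof.
rewrite /swapmx -/(xchg p q); have : xchg p q *m (xchg p q)^t* = 1%:M.
  rewrite /xchg tr_block_mx map_block_mx !trmx0 !trmx1 !map_mx0 !map_mx1.
  by rewrite mulmx_block !(mulmx0, mul0mx, addr0, add0r, mulmx1) -scalar_mx_block.
by move: (xchg p q); case: _ / (addnC q p) => X /unitarymxP; rewrite castmx_id.
Qed.

Lemma swapmx_conj p q (A : 'M[C]_p) (B : 'M[C]_q) :
  Smx (swapmx R p q *m mxdsum A B *m (swapmx R p q)^t*) = Smx (mxdsum B A).
Proof.
rewrite /swapmx -/(xchg p q).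
have : xchg p q *m mxdsum A B *m (xchg p q)^t* = mxdsum B A.
  rewrite /xchg tr_block_mx map_block_mx !trmx0 !trmx1 !map_mx0 !map_mx1.
  by rewrite /mxdsum !mulmx_block !(mulmx0, mul0mx, addr0, add0r, mulmx1, mul1mx).
move: (xchg p q) (mxdsum A B) (mxdsum B A).
by case: _ / (addnC q p) => X D E <-; rewrite castmx_id.
Qed.

End SizedMatrices.

(** * Marked points of a tower *)

Section Marked.
Variables (R : realType) (T : tower R).
Local Notation C := (Cplx R).
Implicit Types (x y z : T).

(* A point of the tower together with a candidate value of a field there.  The
   size of the value is not tied to the point by typing, which makes [msum]
   associative for Leibniz equality; [mwf] states that the sizes agree. *)
Definition marked := (T * smx R)%type.
Implicit Types (p q : marked).

Definition msum p q : marked := (tsum p.1 q.1, smx_dsum p.2 q.2).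
Definition mact n (U : 'M[C]_n) p : marked :=
  (tact U p.1, Smx (U *m mxof n p.2 *m U^t*)).
Definition mwf p := projT1 p.2 = tdim p.1.
Definition mequiv p q :=
  mwf p /\ exists U : 'M[C]_(tdim p.1), U \is unitarymx /\ mact U p = q.

Lemma msumA : associative msum.
Proof. by move=> p q r; rewrite /msum /= tsumA smx_dsumA. Qed.

Lemma mwf_sum p q : mwf p -> mwf q -> mwf (msum p q).
Proof. by rewrite /mwf /= tdim_sum => -> ->. Qed.

Lemma mwf_act n (U : 'M[C]_n) p :
  U \is unitarymx -> tdim p.1 = n -> mwf (mact U p).
Proof. by move=> hU hn; rewrite /mwf /= tdim_act. Qed.

Lemma mact1 n p : tdim p.1 = n -> mwf p -> mact (1%:M : 'M[C]_n) p = p.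
Proof.
case: p => x A /= hn wA; rewrite /mact /= tact1// trmx1 map_mx1 mulmx1 mul1mx.
by rewrite Smx_mxof// wA.
Qed.

Lemma mactM n (U V : 'M[C]_n) p : U \is unitarymx -> V \is unitarymx ->
  tdim p.1 = n -> mact (U *m V) p = mact U (mact V p).
Proof.
move=> hU hV hn; rewrite /mact [RHS]/= mxof_Smx (tactM hU hV hn) adjM.
by rewrite !mulmxA.
Qed.

Lemma mactK n (U : 'M[C]_n) p : U \is unitarymx -> tdim p.1 = n -> mwf p ->
  mact (U^t*) (mact U p) = p.
Proof.
by move=> hU hn wp; rewrite -mactM ?adj_unitary// unitary_adjM// mact1.
Qed.

Lemma tactK n (U : 'M[C]_n) x : U \is unitarymx -> tdim x = n ->
  tact (U^t*) (tact U x) = x.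
Proof. by move=> hU hn; rewrite -tactM ?adj_unitary// unitary_adjM// tact1. Qed.

Lemma mequiv_act n (U : 'M[C]_n) p :
  U \is unitarymx -> tdim p.1 = n -> mwf p -> mequiv p (mact U p).
Proof. by move=> hU hn wp; case: _ / hn in U hU *; split=> //; exists U. Qed.

Lemma mequivP p q : mequiv p q ->
  exists U : 'M[C]_(tdim p.1), [/\ U \is unitarymx, mact U p = q,
    mwf p, mwf q & tdim q.1 = tdim p.1].
Proof.
move=> [wp [U [hU <-]]]; exists U; split=> //; first exact: mwf_act.
exact: tdim_act.
Qed.

Lemma mequiv_at n p q : tdim p.1 = n -> mequiv p q ->
  exists U : 'M[C]_n, [/\ U \is unitarymx, mact U p = q,
    mwf p, mwf q & tdim q.1 = n].
Proof. by move=> <-; exact: mequivP. Qed.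

Lemma mequiv_refl p : mwf p -> mequiv p p.
Proof.
by move=> wp; rewrite -{2}(mact1 erefl wp); apply: mequiv_act => //; exact:
  unitarymx1.
Qed.

Lemma mequiv_sym p q : mequiv p q -> mequiv q p.
Proof.
move=> /mequivP[U [hU <- wp wq e]].
by have := mequiv_act (adj_unitary hU) e wq; rewrite mactK.
Qed.

Lemma mequiv_trans q p r : mequiv p q -> mequiv q r -> mequiv p r.
Proof.
move=> /mequivP[U [hU <- wp wq e]] /(mequiv_at e)[V [hV <- _ _ _]].
rewrite -(mactM hV hU erefl).
exact: (mequiv_act (mul_unitarymx hV hU) erefl wp).
Qed.

Lemma mact_sum n k (U : 'M[C]_n) (V : 'M[C]_k) p q :
  U \is unitarymx -> V \is unitarymx -> tdim p.1 = n -> tdim q.1 = k ->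
  mwf p -> mwf q ->
  mact (mxdsum U V) (msum p q) = msum (mact U p) (mact V q).
Proof.
case: p q => [x [n' A]] [y [k' B]] hU hV /= hn hk; rewrite /mwf /= hn hk => en ek.
case: _ / (esym en) in A *; case: _ / (esym ek) in B *.
rewrite /mact /msum /= tact_sum//; congr pair.
by rewrite /smx_dsum /= !mxof_Smx mxdsum_adj !mxdsumM.
Qed.

Lemma mequiv_sum p p' q q' :
  mequiv p p' -> mequiv q q' -> mequiv (msum p q) (msum p' q').
Proof.
move=> /mequivP[U [hU <- wp _ _]] /mequivP[V [hV <- wq _ _]].
rewrite -mact_sum//; apply: mequiv_act; rewrite ?mxdsum_unitary ?tdim_sum//.
exact: mwf_sum.
Qed.

Lemma mequiv_swap p q : mwf p -> mwf q -> mequiv (msum p q) (msum q p).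
Proof.
move=> wp wq; have -> : msum q p = mact (swapmx R (tdim p.1) (tdim q.1)) (msum p q).
  rewrite /mact /= tact_swap; congr pair.
  case: p q wp wq => [x [n A]] [y [k B]] /=; rewrite /mwf /= => en ek.
  by case: _ / en; case: _ / ek; rewrite /smx_dsum /= mxof_Smx swapmx_conj.
by apply: mequiv_act; rewrite ?swapmx_unitary ?tdim_sum//; exact: mwf_sum.
Qed.

Lemma tequiv_act n (U : 'M[C]_n) x :
  U \is unitarymx -> tdim x = n -> tequiv x (tact U x).
Proof. by move=> hU hn; case: _ / hn in U hU *; exists U. Qed.

Lemma mequiv_fst p q : mequiv p q -> tequiv p.1 q.1.
Proof. by move=> /mequivP[U [hU <- _ _ _]]; exact: tequiv_act. Qed.

(** Conjugation fixes the mark 0, so the equivalence laws for points are inherited from those for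
    marked points. *)
Lemma tequiv_mark x y : tequiv x y <->
  mequiv (x, Smx (0 : 'M[C]_(tdim x))) (y, Smx (0 : 'M[C]_(tdim y))).
Proof.
split=> [[U [hU e]]|]; last exact: mequiv_fst.
split=> //; exists U; split=> //; rewrite /mact /= e; congr pair.
by rewrite mxof_Smx mulmx0 mul0mx -e tdim_act.
Qed.

Lemma tdim_equiv x y : tequiv x y -> tdim y = tdim x.
Proof. by move=> [U [hU <-]]; rewrite tdim_act. Qed.

Lemma tequiv_refl x : tequiv x x.
Proof. by apply/tequiv_mark/mequiv_refl. Qed.

Lemma tequiv_sym x y : tequiv x y -> tequiv y x.
Proof. by move=> /tequiv_mark/mequiv_sym/tequiv_mark. Qed.

Lemma tequiv_trans y x z : tequiv x y -> tequiv y z -> tequiv x z.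
Proof.
by move=> /tequiv_mark h /tequiv_mark h'; apply/tequiv_mark; apply: mequiv_trans
  h h'.
Qed.

Lemma tequiv_sum x x' y y' :
  tequiv x x' -> tequiv y y' -> tequiv (tsum x y) (tsum x' y').
Proof.
move=> /tequiv_mark h /tequiv_mark h'.
exact: (mequiv_fst (mequiv_sum h h')).
Qed.

Lemma treducibleP x : treducible x <-> exists a b, tequiv x (tsum a b).
Proof.
split=> [[V [a [b [hV e]]]]|[a [b [V [hV e]]]]].
  by exists a, b, V.
by exists V, a, b.
Qed.

Lemma irreducible_equiv x y : tequiv x y -> tirreducible x -> tirreducible y.
Proof.
move=> xy ix /treducibleP[a [b h]]; apply: ix; apply/treducibleP.
by exists a, b; exact: tequiv_trans xy h.
Qed.

Lemma tle_equivl x x' y : tequiv x x' -> tle x' y -> tle x y.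
Proof.
move=> xx' [h|[a [b [h h']]]]; [left|right].
  exact: tequiv_trans xx' h.
by exists a, b; split=> //; exact: tequiv_trans xx' h.
Qed.

Lemma tle_equivr x y y' : tequiv y y' -> tle x y -> tle x y'.
Proof.
move=> yy' [h|[a [b [h h']]]]; [left|right].
  exact: tequiv_trans h yy'.
by exists a, b; split=> //; exact: tequiv_trans (tequiv_sym yy') h'.
Qed.

Lemma tle_suml x y z : tle x y -> tle x (tsum y z).
Proof.
move=> [h|[a [b [h h']]]]; right.
  by exists y, z; split=> //; exact: tequiv_refl.
exists a, (tsum b z); split=> //; rewrite tsumA; apply: tequiv_sum h' _.
exact: tequiv_refl.
Qed.

Lemma tle_irreducible x y : tirreducible y -> tle x y -> tequiv x y.
Proof.
move=> iy [//|[a [b [_ h]]]]; exfalso; apply: iy; apply/treducibleP.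
by exists a, b.
Qed.

Lemma not_disjoint_irreducible x y :
  tirreducible y -> ~ tdisjoint y x -> tle y x.
Proof.
move=> iy /contrapT[a [/(tle_irreducible iy) ay ax]].
exact: tle_equivl (tequiv_sym ay) ax.
Qed.

Lemma tle_not_disjoint x y : tle y x -> ~ tdisjoint y x.
Proof. by move=> h; apply; exists y; split=> //; left; exact: tequiv_refl. Qed.

Lemma tdisjoint_sym x y : tdisjoint x y -> tdisjoint y x.
Proof. by move=> h [a [h1 h2]]; apply: h; exists a. Qed.

(** Strong induction on the dimension: both summands of a reducible point are smaller because [tdim]
    is positive. It stands in for an explicit decomposition into irreducible summands. *)
Lemma tower_ind (P : T -> Prop) :
  (forall x y, tequiv x y -> P x -> P y) ->
  (forall x, tirreducible x -> P x) ->
  (forall x y, P x -> P y -> P (tsum x y)) -> forall x, P x.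
Proof.
move=> Peq Pirr Psum x; have [n] := ubnP (tdim x); elim: n x => // n IH x hx.
have [/treducibleP[a [b e]]|/Pirr//] := EM (treducible x).
apply: Peq (tequiv_sym e) _; have := tdim_equiv e; rewrite tdim_sum => ed.
have := tdim_gt0 a; have := tdim_gt0 b => *.
by apply: Psum; apply: IH; lia.
Qed.

Lemma irreducible_le x : exists2 y, tirreducible y & tle y x.
Proof.
elim/tower_ind: x => [x y e [z iz h]|x ix|x y [z iz h] _].
- by exists z => //; exact: tle_equivr e h.
- by exists x => //; left; exact: tequiv_refl.
- by exists z => //; exact: tle_suml.
Qed.

End Marked.

(** * Extension from the irreducible points *)

Section Generated.
Variables (R : realType) (T : tower R).
Local Notation C := (Cplx R).
Implicit Types (x y z : T) (p q : marked T).

Definition sized (g : T -> smx R) := forall x, projT1 (g x) = tdim x.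

Definition conj_at (g : T -> smx R) x := forall n (U : 'M[C]_n),
  U \is unitarymx -> tdim x = n ->
  g (tact U x) = Smx (U *m mxof n (g x) *m U^t*).

Definition additive_field (g : T -> smx R) :=
  forall x y, g (tsum x y) = smx_dsum (g x) (g y).

Section Extension.
Hypothesis hT : m_tower T.
Variable g : T -> smx R.
Hypothesis g_sized : sized g.
Hypothesis g_conj : forall x, tirreducible x -> conj_at g x.

(* The graph of the additive equivariant extension of [g]; the point is that it
   is single-valued, see [generated_inj]. *)
Inductive generated : marked T -> Prop :=
| generated_irr x : tirreducible x -> generated (x, g x)
| generated_sum p q : generated p -> generated q -> generated (msum p q)
| generated_equiv p q : generated p -> mequiv p q -> generated q.

Lemma generated_wf p : generated p -> mwf p.
Proof.
elim=> [x _|{}p q _ hp _ hq|{}p q _ hp /mequivP[U []//]]; first exact: g_sized.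
exact: mwf_sum.
Qed.

Lemma mact_irr n (U : 'M[C]_n) x : tirreducible x -> U \is unitarymx ->
  tdim x = n -> mact U (x, g x) = (tact U x, g (tact U x)).
Proof. by move=> ix hU hn; rewrite /mact /= (g_conj ix hU hn). Qed.

(** By (mT1) an irreducible [y] that is not disjoint from a sum is not disjoint from one of the
    summands. Carrying the marks along shows that the copy of [y] split off has the value [g y]. *)
Lemma generated_extract p y : generated p -> tirreducible y ->
  ~ tdisjoint y p.1 ->
  mequiv p (y, g y) \/ exists q, generated q /\ mequiv p (msum (y, g y) q).
Proof.
move=> + iy; elim=> [x ix|{}p q gp IHp gq IHq|{}p q gp IHp e] /= nd.
- have /(tle_irreducible ix)/tequiv_sym[U [hU e]] := not_disjoint_irreducible iy nd.
  left; rewrite -e -mact_irr//; exact: (@mequiv_act _ _ _ U (x, g x)) hU erefl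
    (g_sized x).
- have wp := generated_wf gp; have wq := generated_wf gq.
  right; have [dp|/IHp ndp] := EM (tdisjoint y p.1); last first.
    case: ndp => [e|[r [gr e]]].
      by exists q; split=> //; apply: mequiv_sum e _; exact: mequiv_refl.
    exists (msum r q); split; first exact: generated_sum.
    by rewrite msumA; apply: mequiv_sum e _; exact: mequiv_refl.
  have [dq|/IHq ndq] := EM (tdisjoint y q.1).
    by exfalso; apply: nd; exact: mtower_disjoint_sum.
  case: ndq => [e|[r [gr e]]].
    exists p; split=> //; apply: mequiv_trans (mequiv_swap wp wq) _.
    by apply: mequiv_sum e _; exact: mequiv_refl.
  exists (msum r p); split; first exact: generated_sum.
  apply: mequiv_trans (mequiv_swap wp wq) _.
  by rewrite msumA; apply: mequiv_sum e _; exact: mequiv_refl.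
- have /IHp[e'|[r [gr e']]] : ~ tdisjoint y p.1.
    move=> d; apply: nd => -[a [h1 h2]]; apply: d; exists a; split=> //.
    exact: tle_equivr (tequiv_sym (mequiv_fst e)) h2.
  + by left; exact: mequiv_trans (mequiv_sym e) e'.
  + by right; exists r; split=> //; exact: mequiv_trans (mequiv_sym e) e'.
Qed.

(** Marked counterpart of [nfold]; like it, it gives one copy for [m = 0], whence the positivity
    conditions below. *)
Definition mnfold m p := iter m.-1 (msum p) p.

Lemma mnfold_fst m p : (mnfold m p).1 = nfold m p.1.
Proof. by rewrite /mnfold /nfold; elim: (m.-1) => //= k ->. Qed.

Lemma mnfoldS m p : (0 < m)%N -> mnfold m.+1 p = msum p (mnfold m p).
Proof. by case: m. Qed.

Lemma mnfold_wf m p : mwf p -> mwf (mnfold m p).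
Proof. by move=> wp; rewrite /mnfold; elim: (m.-1) => //= k; exact: mwf_sum. Qed.

Lemma tdim_nfold m x : (0 < m)%N -> tdim (nfold m x) = (m * tdim x)%N.
Proof.
case: m => // m _; rewrite /nfold /=; elim: m => [|m IH] /=; first by rewrite mul1n.
by rewrite tdim_sum IH mulSn.
Qed.

(** Copies of [y] are split off, lowering the dimension, until the remainder is disjoint from [y],
    as (mT3) requires. *)
Lemma generated_group p y : generated p -> tirreducible y ->
  ~ tdisjoint y p.1 -> exists2 m, (0 < m)%N &
    mequiv p (mnfold m (y, g y)) \/
    exists q, [/\ generated q, tdisjoint y q.1 &
      mequiv p (msum (mnfold m (y, g y)) q)].
Proof.
move=> + iy; have [n] := ubnP (tdim p.1).
elim: n p => // n IH p hn gp /(generated_extract gp iy)[e|[q [gq e]]].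
  by exists 1%N => //; left.
have [dq|ndq] := EM (tdisjoint y q.1).
  by exists 1%N => //; right; exists q.
have hq : (tdim q.1 < n)%N.
  have := tdim_equiv (mequiv_fst e); rewrite /= tdim_sum.
  by have := tdim_gt0 y; lia.
have wy : mequiv (y, g y) (y, g y) by exact/mequiv_refl/g_sized.
have [m m0 [e'|[r [gr dr e']]]] := IH q hq gq ndq; exists m.+1 => //.
  by left; apply: mequiv_trans e _; rewrite mnfoldS//; exact: mequiv_sum.
right; exists r; split=> //; apply: mequiv_trans e _.
by rewrite mnfoldS// -msumA; exact: mequiv_sum.
Qed.

(** The obstruction to a well-defined equivariant value: two marks of one orbit over the same point
    differ by an element of the stabilizer. *)
Definition stab_fixes p := forall n (U : 'M[C]_n),
  tdim p.1 = n -> U \is unitarymx -> tact U p.1 = p.1 -> mact U p = p.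

(** Equivalent points have conjugate stabilizers. *)
Lemma stab_fixes_equiv p q : mequiv p q -> stab_fixes q -> stab_fixes p.
Proof.
move=> pq hq n U hn hU hx; have [W [hW e wp wq dq]] := mequiv_at hn pq.
have hW' := adj_unitary hW; have hWU := mul_unitarymx hW hU.
have tq : tact (W *m U *m W^t*) q.1 = q.1.
  by rewrite (tactM hWU hW' dq) -e /= (tactK hW hn) (tactM hW hU hn) hx.
have := hq n _ dq (mul_unitarymx hWU hW') tq.
rewrite (mactM hWU hW' dq) -e (mactK hW hn wp) (mactM hW hU hn).
move=> /(congr1 (mact (W^t*))) eW.
have hq1 : tdim (mact U p).1 = n by rewrite /= hx.
exact: etrans (esym (mactK hW hq1 (mwf_act hU hn))) (etrans eW (mactK hW hn wp)).
Qed.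

(** Leads to the form [1 *t A] for the value of an m-fold sum, which commutes with the stabilizing
    elements [u *t 1] of (mT4). *)
Lemma tens1mxS m d (A : 'M[C]_d) :
  (1%:M : 'M[C]_m.+1) *t A = mxdsum A ((1%:M : 'M[C]_m) *t A).
Proof.
apply/matrixP => i j; rewrite [LHS]mxE /mxdsum.
have lA (k : 'I_d) : mxtens_unindex (lshift (m * d) k : 'I_(m.+1 * d)) = (ord0, k).
  apply: (can_inj (@mxtens_indexK m.+1 d)); rewrite mxtens_unindexK.
  by apply: val_inj; rewrite /= mul0n.
have rA (k : 'I_(m * d)) : mxtens_unindex (rshift d k : 'I_(m.+1 * d)) =
    (lift ord0 (mxtens_unindex k).1, (mxtens_unindex k).2).
  apply: (can_inj (@mxtens_indexK m.+1 d)); rewrite mxtens_unindexK.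
  apply: val_inj => /=; rewrite /bump /= add1n mulSn -addnA; congr addn.
  by rewrite -divn_eq.
have sp (k : 'I_(m.+1 * d)) :
    (exists a, k = lshift (m * d) a) \/ (exists b, k = rshift d b).
  by case: (@fintype.split_ordP d (m * d) k) => a ->; [left|right]; exists a.
case: (sp i) => -[i' ->]; case: (sp j) => -[j' ->].
- by rewrite block_mxEul !lA mxE eqxx mul1r.
- by rewrite block_mxEur lA rA !mxE mul0r.
- by rewrite block_mxEdl lA rA !mxE mul0r.
- by rewrite block_mxEdr !rA !mxE (inj_eq lift_inj).
Qed.

Lemma mnfold_snd m d (A : 'M[C]_d) x :
  (0 < m)%N -> (mnfold m (x, Smx A)).2 = Smx ((1%:M : 'M[C]_m) *t A).
Proof.
elim: m => // -[_ _|m IH _].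
  by rewrite /mnfold /= tens_scalar1mx (Smx_castmx (esym (mul1n d))).
by rewrite mnfoldS// tens1mxS /= IH.
Qed.

Lemma mnfold_stab_fixes m y :
  (0 < m)%N -> tirreducible y -> stab_fixes (mnfold m (y, g y)).
Proof.
move=> m0 iy n U; rewrite mnfold_fst tdim_nfold//= => hn.
case: _ / hn in U * => hU hx.
have : stab (m * tdim y)%N (nfold m y) U by [].
rewrite (mtower_stab_nfold hT iy m0) => -[u /= hu eU].
rewrite [RHS]surjective_pairing /mact; congr pair.
  by rewrite mnfold_fst.
rewrite -(Smx_mxof (g_sized y)) mnfold_snd// mxof_Smx; congr Smx.
rewrite -eU trmx_tens map_mxT !tensmx_mul !(mulmx1, mul1mx) trmx1 map_mx1 mulmx1.
by rewrite unitary_Madj.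
Qed.

Lemma disjoint_nfold y z m :
  (0 < m)%N -> tdisjoint y z -> tdisjoint (nfold m y) z.
Proof.
case: m => // m _ /tdisjoint_sym d; apply: tdisjoint_sym.
by rewrite /nfold /=; elim: m => //= m; exact: mtower_disjoint_sum.
Qed.

Lemma stab_fixes_sum p q : mwf p -> mwf q -> tdisjoint p.1 q.1 ->
  stab_fixes p -> stab_fixes q -> stab_fixes (msum p q).
Proof.
move=> wp wq d hp hq n U /=; rewrite tdim_sum => hn.
case: _ / hn in U * => hU hx.
have : stab (tdim p.1 + tdim q.1)%N (tsum p.1 q.1) U by split.
rewrite (mtower_stab_disjoint hT d) => -[V [W [[hV eV] [hW eW] ->]]].
rewrite (mact_sum hV hW erefl erefl wp wq).
by rewrite (hp _ V erefl hV eV) (hq _ W erefl hW eW).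
Qed.

(** Induction on the dimension: (mT4) settles a multiple of one irreducible element, and (mT3)
    splits the stabilizer when a disjoint remainder is present. *)
Lemma generated_stab_fixes p : generated p -> stab_fixes p.
Proof.
have [n] := ubnP (tdim p.1); elim: n p => // n IH p hn gp.
have [y iy /tle_not_disjoint nd] := irreducible_le p.1.
have [m m0 [e|[q [gq d e]]]] := generated_group gp iy nd.
  by apply: stab_fixes_equiv e _; exact: mnfold_stab_fixes.
apply: (stab_fixes_equiv e); apply: stab_fixes_sum.
- exact/mnfold_wf/g_sized.
- exact: generated_wf.
- by rewrite mnfold_fst; exact: disjoint_nfold.
- exact: mnfold_stab_fixes.
apply: IH => //; have := tdim_equiv (mequiv_fst e).
by rewrite /= tdim_sum mnfold_fst tdim_nfold//=; have := tdim_gt0 y; nia.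
Qed.

Lemma stab_fixes_eq p q : stab_fixes p -> mequiv p q -> p.1 = q.1 -> p = q.
Proof.
move=> sp /mequivP[U [hU e _ _ _]] epq; rewrite -e; apply/esym; apply: sp => //.
by rewrite [RHS]epq -e.
Qed.

(** The same irreducible [y] is split off from both marks. (mT2) makes the remainders equivalent, so
    after a unitary move they coincide by induction. Thus [p] and [q] lie in one orbit over one
    point, where [generated_stab_fixes] forces equality. *)
Lemma generated_inj p q : generated p -> generated q -> p.1 = q.1 -> p = q.
Proof.
have [n] := ubnP (tdim p.1); elim: n p q => // n IH p q hn gp gq epq.
apply: (stab_fixes_eq (generated_stab_fixes gp) _ epq).
have [y iy /tle_not_disjoint ndp] := irreducible_le p.1.
have ndq : ~ tdisjoint y q.1 by rewrite -epq.
(* Excludes the mixed case: [y] alone on one side, [y] plus a remainder on the other. *)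
have red a b r : a = b -> tequiv a y -> tequiv b (tsum y r) -> False.
  move=> -> e e'; apply: iy; apply/treducibleP; exists y, r.
  exact: tequiv_trans (tequiv_sym e) e'.
have [e|[p' [gp' e]]] := generated_extract gp iy ndp.
  have [e'|[q' [gq' /mequiv_fst e']]] := generated_extract gq iy ndq.
    exact: mequiv_trans e (mequiv_sym e').
  by case: (red _ _ _ epq (mequiv_fst e) e').
have [e'|[q' [gq' e']]] := generated_extract gq iy ndq.
  by case: (red _ _ _ (esym epq) (mequiv_fst e') (mequiv_fst e)).
apply: (mequiv_trans e (mequiv_trans _ (mequiv_sym e'))).
apply: mequiv_sum; first exact/mequiv_refl/g_sized.
have /(mtower_cancel hT) : tequiv (tsum y p'.1) (tsum y q'.1).
  apply: (tequiv_trans (tequiv_sym (mequiv_fst e))); rewrite epq.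
  exact: (mequiv_fst e').
move=> [U [hU eU]].
have h := mequiv_act hU erefl (generated_wf gp').
apply: (mequiv_trans h); rewrite (_ : mact U p' = q').
  exact/mequiv_refl/generated_wf.
apply: IH => //; last exact: generated_equiv h.
have := tdim_equiv (mequiv_fst e); rewrite /= tdim_act// tdim_sum.
by have := tdim_gt0 y; lia.
Qed.

Lemma generated_total x : exists A, generated (x, A).
Proof.
elim/tower_ind: x => [x y [U [hU <-]] [A gA]|x ix|x y [A gA] [B gB]].
- exists (mact U (x, A)).2.
  exact: generated_equiv gA (@mequiv_act _ _ _ U (x, A) hU erefl (generated_wf gA)).
- by exists (g x); exact: generated_irr.
- by exists (smx_dsum A B); exact: (generated_sum gA gB).
Qed.

Lemma irreducible_extension : exists G : T -> smx R,
  [/\ sized G, forall x, conj_at G x, additive_field G &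
      forall x, tirreducible x -> G x = g x].
Proof.
have [G hG] := choice generated_total; exists G.
have inj x A : generated (x, A) -> G x = A.
  by move=> h; case: (generated_inj (hG x) h erefl).
split=> [x|x n U hU hn|x y|x ix].
- exact: (generated_wf (hG x)).
- apply: inj; apply: generated_equiv (hG x) _.
  exact: (@mequiv_act _ _ _ U (x, G x) hU hn (generated_wf (hG x))).
- exact/inj/(generated_sum (hG x) (hG y)).
- exact/inj/generated_irr.
Qed.

End Extension.

(** [Q] passes to equivalent points and to summands, so the induction stays inside it; it will be
    [S] or the set of points of dimension below [N]. *)
Lemma additive_field_eq (G G' : T -> smx R) (Q : set T) :
  sized G -> sized G' -> (forall x, conj_at G x) -> (forall x, conj_at G' x) ->
  additive_field G -> additive_field G' ->
  (forall x y, tequiv x y -> Q x -> Q y) ->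
  (forall x y, Q (tsum x y) -> Q x /\ Q y) ->
  (forall x, Q x -> tirreducible x -> G x = G' x) ->
  forall x, Q x -> G x = G' x.
Proof.
move=> sG sG' cG cG' aG aG' Qe Qs Qi; elim/tower_ind.
- move=> x y [U [hU e]] IH Qy.
  have Qx : Q x by apply: Qe Qy; apply: tequiv_sym; exists U.
  by rewrite -e (cG x _ U hU erefl) (cG' x _ U hU erefl) IH.
- by move=> x ix Qx; exact: Qi.
- by move=> x y IHx IHy /Qs[Qx Qy]; rewrite aG aG' IHx// IHy.
Qed.

End Generated.

(** * Euclidean and operator norms *)

Section Norms.
Variable R : realType.
Local Notation C := (Cplx R).
Local Notation nc := (@Normc.normc R).

Definition rc (r : R) : C := real_complex R r.

Lemma normcC (x : C) : `|x| = rc (nc x).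
Proof. by case: x => a b; rewrite normc_def. Qed.

Lemma nc_ge0 (x : C) : 0 <= nc x.
Proof. by case: x => a b; exact: sqrtr_ge0. Qed.

Lemma nc_rc (r : R) : 0 <= r -> nc (rc r) = r.
Proof. by move=> r0; rewrite /rc /= expr0n addr0 sqrtr_sqr ger0_norm. Qed.

Lemma rcM (a b : R) : rc (a * b) = rc a * rc b. Proof. exact: rmorphM. Qed.
Lemma rcD (a b : R) : rc (a + b) = rc a + rc b. Proof. exact: rmorphD. Qed.
Lemma rcX (a : R) n : rc (a ^+ n) = rc a ^+ n. Proof. exact: rmorphXn. Qed.
Lemma rc_sum I (s : seq I) (F : I -> R) :
  rc (\sum_(i <- s) F i) = \sum_(i <- s) rc (F i).
Proof. exact: rmorph_sum. Qed.
Lemma rc_le (a b : R) : (rc a <= rc b) = (a <= b). Proof. exact: lecR. Qed.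
Lemma rc_inj : injective rc. Proof. exact: complexI. Qed.

Lemma ncM (x y : C) : nc (x * y) = nc x * nc y. Proof. exact: Normc.normcM. Qed.
Lemma ncD (x y : C) : nc (x + y) <= nc x + nc y. Proof. exact: le_normcD. Qed.
Lemma ncN (x : C) : nc (- x) = nc x. Proof. exact: normcN. Qed.
Lemma nc0 : nc 0 = 0. Proof. exact: Normc.normc0. Qed.

Lemma nc_sum I (s : seq I) (F : I -> C) :
  nc (\sum_(i <- s) F i) <= \sum_(i <- s) nc (F i).
Proof.
elim/big_rec2: _ => [|i y x _ h]; first by rewrite nc0.
by apply: le_trans (ncD _ _) _; rewrite lerD2l.
Qed.

Lemma l2norm_ge0 n (v : 'cV[C]_n) : 0 <= l2norm v.
Proof. exact: sqrtr_ge0. Qed.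

Lemma l2norm_sqr n (v : 'cV[C]_n) : l2norm v ^+ 2 = \sum_i nc (v i 0) ^+ 2.
Proof. by rewrite sqr_sqrtr// sumr_ge0// => i _; rewrite exprn_ge0// nc_ge0. Qed.

Lemma l2norm_le n m (v : 'cV[C]_n) (w : 'cV[C]_m) :
  (l2norm v <= l2norm w) = (l2norm v ^+ 2 <= l2norm w ^+ 2).
Proof. by rewrite ler_pXn2r// nnegrE l2norm_ge0. Qed.

Definition hdot n (u v : 'cV[C]_n) : C := (v^t* *m u) 0 0.

(** Transposition leads to the hermitian form [dotmx] on rows, the source of the Cauchy-Schwarz and
    triangle inequalities below. *)
Lemma hdot_dotmx n (u v : 'cV[C]_n) : hdot u v = dotmx (u^T) (v^T).
Proof.
rewrite dotmxE /hdot -[in LHS](trmxK (v^t* *m u)) [LHS]mxE trmx_mul.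
by rewrite map_trmx trmxK.
Qed.

Lemma hdot_l2norm n (v : 'cV[C]_n) : hdot v v = rc (l2norm v ^+ 2).
Proof.
rewrite l2norm_sqr rc_sum /hdot mxE; apply: eq_bigr => i _.
by rewrite !mxE rcX -normcC normCK mulrC.
Qed.

Lemma l2norm_sqrtC n (v : 'cV[C]_n) : rc (l2norm v) = sqrtC (dotmx v^T v^T).
Proof.
by rewrite -hdot_dotmx hdot_l2norm rcX sqrCK// (rc_le 0) l2norm_ge0.
Qed.

Lemma hdotDl n (u v w : 'cV[C]_n) : hdot (u + v) w = hdot u w + hdot v w.
Proof. by rewrite /hdot mulmxDr mxE. Qed.

Lemma hdotBl n (u v w : 'cV[C]_n) : hdot (u - v) w = hdot u w - hdot v w.
Proof. by rewrite /hdot mulmxBr !mxE. Qed.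

Lemma hdotZl n c (u v : 'cV[C]_n) : hdot (c *: u) v = c * hdot u v.
Proof. by rewrite /hdot -scalemxAr mxE. Qed.

Lemma hdotBr n (u v w : 'cV[C]_n) : hdot w (u - v) = hdot w u - hdot w v.
Proof. by rewrite /hdot linearB /= map_mxB mulmxBl !mxE. Qed.

Lemma hdot_adjl n (A : 'M[C]_n) u v : hdot (A *m u) v = hdot u (A^t* *m v).
Proof. by rewrite /hdot adjM mulmxA trmxCK. Qed.

Lemma hdot_cauchy n (u v : 'cV[C]_n) : nc (hdot u v) <= l2norm u * l2norm v.
Proof.
rewrite -rc_le -normcC rcM !l2norm_sqrtC hdot_dotmx.
exact: (CauchySchwarz_sqrt (dotmx (n:=n)) u^T v^T).1.
Qed.

Lemma l2normD n (u v : 'cV[C]_n) : l2norm (u + v) <= l2norm u + l2norm v.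
Proof.
rewrite -rc_le rcD !l2norm_sqrtC linearD.
exact: (triangle_lerif (dotmx (n:=n)) u^T v^T).1.
Qed.

Lemma l2normZ n (c : C) (v : 'cV[C]_n) : l2norm (c *: v) = nc c * l2norm v.
Proof.
apply/eqP; rewrite -(@eqrXn2 _ 2)// ?mulr_ge0 ?l2norm_ge0 ?nc_ge0//.
rewrite exprMn !l2norm_sqr mulr_sumr; apply/eqP; apply: eq_bigr => i _.
by rewrite mxE ncM exprMn.
Qed.

Lemma l2norm0 n : l2norm (0 : 'cV[C]_n) = 0.
Proof. by rewrite -(scale0r 0) l2normZ nc0 mul0r. Qed.

Lemma l2norm_eq0 n (v : 'cV[C]_n) : l2norm v = 0 -> v = 0.
Proof.
move=> h; have := l2norm_sqr v; rewrite h expr0n /= => /esym/eqP.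
rewrite psumr_eq0 => [/allP h'|i _]; last by rewrite exprn_ge0// nc_ge0.
apply/matrixP => i j; rewrite ord1 mxE; apply/Normc.eq0_normc/eqP.
by have := h' i (mem_index_enum i); rewrite /= sqrf_eq0.
Qed.

Lemma l2norm_entry n (v : 'cV[C]_n) i : nc (v i 0) <= l2norm v.
Proof.
rewrite -(@ler_pXn2r _ 2)// ?nnegrE ?nc_ge0 ?l2norm_ge0// l2norm_sqr (bigD1 i)//=.
by rewrite lerDl sumr_ge0// => j _; rewrite exprn_ge0// nc_ge0.
Qed.

Lemma l2norm_le_sum n (v : 'cV[C]_n) : l2norm v <= \sum_i nc (v i 0).
Proof.
have S0 : 0 <= \sum_i nc (v i 0) by rewrite sumr_ge0// => i _; exact: nc_ge0.
rewrite -(@ler_pXn2r _ 2)// ?nnegrE ?l2norm_ge0// l2norm_sqr [leRHS]expr2.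
rewrite mulr_suml ler_sum// => i _; rewrite expr2 ler_wpM2l ?nc_ge0//.
by rewrite (bigD1 i)//= lerDl sumr_ge0// => j _; exact: nc_ge0.
Qed.

Lemma l2norm_unitary n (U : 'M[C]_n) v : U \is unitarymx ->
  l2norm (U *m v) = l2norm v.
Proof.
move=> hU; apply/eqP; rewrite -(@eqrXn2 _ 2)// ?l2norm_ge0//.
apply/eqP/rc_inj; rewrite -2!hdot_l2norm hdot_adjl mulmxA (unitary_adjM hU).
by rewrite mul1mx.
Qed.

Lemma l2norm_col n k (u : 'cV[C]_n) (v : 'cV[C]_k) :
  l2norm (col_mx u v) ^+ 2 = l2norm u ^+ 2 + l2norm v ^+ 2.
Proof.
rewrite !l2norm_sqr big_split_ord /=.
by congr (_ + _); apply: eq_bigr => i _; rewrite ?col_mxEu ?col_mxEd.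
Qed.

Definition absum n (A : 'M[C]_n) : R := \sum_i \sum_j nc (A i j).

Lemma absum_ge0 n (A : 'M[C]_n) : 0 <= absum A.
Proof. by do 2![apply: sumr_ge0 => ? _]; exact: nc_ge0. Qed.

Lemma l2norm_mul_absum n (A : 'M[C]_n) v : l2norm (A *m v) <= absum A * l2norm v.
Proof.
apply: le_trans (l2norm_le_sum _) _; rewrite mulr_suml ler_sum// => i _.
rewrite mxE; apply: le_trans (nc_sum _ _) _; rewrite mulr_suml ler_sum// => j _.
by rewrite ncM ler_wpM2l ?nc_ge0// l2norm_entry.
Qed.

Lemma opnorm_has_sup n (A : 'M[C]_n) :
  has_sup [set l2norm (A *m v) | v in [set v : 'cV[C]_n | l2norm v <= 1]].
Proof.
split; first by exists 0, 0; rewrite /= ?mulmx0 l2norm0.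
exists (absum A) => _ [v /= v1 <-]; apply: le_trans (l2norm_mul_absum _ _) _.
by rewrite ler_piMr// absum_ge0.
Qed.

Lemma opnorm_ge0 n (A : 'M[C]_n) : 0 <= opnorm A.
Proof.
apply: sup_upper_bound; first exact: opnorm_has_sup.
by exists 0; rewrite /= ?mulmx0 l2norm0.
Qed.

Lemma l2norm_mul n (A : 'M[C]_n) v : l2norm (A *m v) <= opnorm A * l2norm v.
Proof.
have [/l2norm_eq0 ->|v0] := eqVneq (l2norm v) 0; first by rewrite mulmx0
  !l2norm0 mulr0.
have vp : 0 < l2norm v by rewrite lt_def v0 l2norm_ge0.
have e : v = rc (l2norm v) *: (rc (l2norm v)^-1 *: v).
  by rewrite scalerA -rcM mulfV// scale1r.
rewrite {1}e -scalemxAr l2normZ nc_rc ?l2norm_ge0// mulrC ler_wpM2r ?l2norm_ge0//.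
apply: sup_upper_bound; first exact: opnorm_has_sup.
exists (rc (l2norm v)^-1 *: v) => //=; rewrite l2normZ nc_rc ?invr_ge0
  ?l2norm_ge0//.
by rewrite mulVf.
Qed.

Lemma opnorm_le n (A : 'M[C]_n) (c : R) : 0 <= c ->
  (forall v, l2norm (A *m v) <= c * l2norm v) -> opnorm A <= c.
Proof.
move=> c0 h; apply: ge_sup; first exact: (opnorm_has_sup A).1.
move=> _ [v /= v1 <-]; apply: le_trans (h v) _.
by rewrite ler_piMr.
Qed.

Lemma opnorm_le_absum n (A : 'M[C]_n) : opnorm A <= absum A.
Proof. by apply: opnorm_le; [exact: absum_ge0|exact: l2norm_mul_absum]. Qed.

Lemma opnormD n (A B : 'M[C]_n) : opnorm (A + B) <= opnorm A + opnorm B.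
Proof.
apply: opnorm_le; first by rewrite addr_ge0 ?opnorm_ge0.
move=> v; rewrite mulmxDl mulrDl; apply: le_trans (l2normD _ _) _.
by rewrite lerD ?l2norm_mul.
Qed.

Lemma opnormM n (A B : 'M[C]_n) : opnorm (A *m B) <= opnorm A * opnorm B.
Proof.
apply: opnorm_le; first by rewrite mulr_ge0 ?opnorm_ge0.
move=> v; rewrite -mulmxA -mulrA; apply: le_trans (l2norm_mul _ _) _.
by rewrite ler_wpM2l ?opnorm_ge0// l2norm_mul.
Qed.

Lemma opnormZ_le n c (A : 'M[C]_n) : opnorm (c *: A) <= nc c * opnorm A.
Proof.
apply: opnorm_le; first by rewrite mulr_ge0 ?opnorm_ge0 ?nc_ge0.
move=> v; rewrite -scalemxAl l2normZ -mulrA.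
by rewrite ler_wpM2l ?nc_ge0// l2norm_mul.
Qed.

Lemma opnorm0 n : opnorm (0 : 'M[C]_n) = 0.
Proof.
apply/le_anti; rewrite opnorm_ge0 andbT; apply: opnorm_le => // v.
by rewrite mul0mx l2norm0 mul0r.
Qed.

Lemma opnormN n (A : 'M[C]_n) : opnorm (- A) = opnorm A.
Proof.
suff h (B : 'M[C]_n) : opnorm (- B) <= opnorm B.
  have hA := h (- A); rewrite opprK in hA.
  by apply/le_anti/andP; split; [exact: h|exact: hA].
rewrite -scaleN1r; apply: le_trans (opnormZ_le _ _) _.
by rewrite ncN Normc.normc1 mul1r.
Qed.

Lemma opnormB n (A B : 'M[C]_n) : opnorm (A - B) <= opnorm A + opnorm B.
Proof. by rewrite -(opnormN B) opnormD. Qed.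

Lemma opnorm_dist n (A B : 'M[C]_n) : `|opnorm A - opnorm B| <= opnorm (A - B).
Proof.
have h (D E : 'M[C]_n) : opnorm D - opnorm E <= opnorm (D - E).
  rewrite lerBlDr; have := opnormD (D - E) E; rewrite subrK; exact.
have hBA := h B A; rewrite -(opnormN (B - A)) opprB in hBA.
by rewrite ler_norml h andbT lerNl opprB.
Qed.

Lemma opnorm_unitary n (U : 'M[C]_n) : U \is unitarymx -> opnorm U <= 1.
Proof. by move=> hU; apply: opnorm_le => // v; rewrite l2norm_unitary// mul1r. Qed.

Lemma opnorm_conj n (U A : 'M[C]_n) : U \is unitarymx ->
  opnorm (U *m A *m U^t*) = opnorm A.
Proof.
move=> hU; have h (V B : 'M[C]_n) : V \is unitarymx -> opnorm (V *m B *m V^t*)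
  <= opnorm B.
  move=> hV; apply: (le_trans (opnormM (V *m B) (V^t*))).
  apply: (le_trans (ler_piMr (opnorm_ge0 _) (opnorm_unitary (adj_unitary hV)))).
  apply: (le_trans (opnormM V B)).
  exact: (ler_piMl (opnorm_ge0 _) (opnorm_unitary hV)).
apply/le_anti/andP; split; first exact: h hU.
have hA := h _ (U *m A *m U^t*) (adj_unitary hU).
suff e : U^t* *m (U *m A *m U^t*) *m U^t* ^t* = A by rewrite e in hA.
rewrite trmxCK 2!mulmxA (unitary_adjM hU) mul1mx -mulmxA (unitary_adjM hU).
by rewrite mulmx1.
Qed.

Lemma opnorm_dsum n k (A : 'M[C]_n) (B : 'M[C]_k) (c : R) :
  opnorm A <= c -> opnorm B <= c -> opnorm (mxdsum A B) <= c.
Proof.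
move=> hA hB; have c0 : 0 <= c := le_trans (opnorm_ge0 A) hA.
apply: opnorm_le => // v; rewrite -(vsubmxK v).
rewrite /mxdsum mul_block_col !mul0mx addr0 add0r.
rewrite -(@ler_pXn2r _ 2)// ?nnegrE ?mulr_ge0 ?l2norm_ge0// exprMn !l2norm_col
  mulrDr.
by rewrite -!exprMn lerD// ler_pXn2r ?nnegrE ?mulr_ge0 ?l2norm_ge0//;
  apply: le_trans (l2norm_mul _ _) _; rewrite ler_wpM2r ?l2norm_ge0.
Qed.

Lemma opnorm_entry n (A : 'M[C]_n) i j : nc (A i j) <= opnorm A.
Proof.
have -> : A i j = (A *m delta_mx j 0 : 'cV[C]_n) i 0.
  by rewrite -colE mxE.
apply: le_trans (l2norm_entry _ _) _; apply: le_trans (l2norm_mul _ _) _.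
rewrite ler_piMr ?opnorm_ge0// -(@ler_pXn2r _ 2)// ?nnegrE ?l2norm_ge0// l2norm_sqr.
have ncb (b : bool) : nc (b%:R : C) = b%:R.
  by case: b; [exact: Normc.normc1|exact: nc0].
rewrite (bigD1 j)//= big1 => [|k /negPf kj]; rewrite mxE ncb ?kj ?eqxx ?expr0n//=.
by rewrite addr0.
Qed.

(** With [w = A^t* *m v], the square of the norm of [w] is [hdot (A *m w) v], at most [opnorm A]
    times the norms of [w] and [v]; divide by the norm of [w]. *)
Lemma opnorm_adj n (A : 'M[C]_n) : opnorm (A^t*) <= opnorm A.
Proof.
apply: opnorm_le; rewrite ?opnorm_ge0// => v.
have [->|v0] := eqVneq (l2norm (A^t* *m v)) 0.
  by rewrite mulr_ge0 ?opnorm_ge0 ?l2norm_ge0.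
have vp : 0 < l2norm (A^t* *m v) by rewrite lt_def v0 l2norm_ge0.
rewrite -(ler_pM2r vp) -expr2 -[leLHS]nc_rc ?exprn_ge0 ?l2norm_ge0//.
rewrite -hdot_l2norm -hdot_adjl; apply: le_trans (hdot_cauchy _ _) _.
by rewrite mulrAC ler_wpM2r ?l2norm_ge0// l2norm_mul.
Qed.

End Norms.

(* Unfolding these makes unification compare suprema of sets of vectors. *)
Local Opaque opnorm l2norm.

(** * Topology of matrix spaces *)

Section MatrixTopology.
Variable R : realType.
Local Notation C := (Cplx R).
Local Notation nc := (@Normc.normc R).

Lemma gtC_rc (e : C) : 0 < e -> exists2 r : R, 0 < r & e = rc r.
Proof.
case: e => a b; rewrite ltcE /= => /andP[/eqP b0 a0]; exists a => //.
by rewrite b0.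
Qed.

Lemma nbhs_nc (x : C) (W : set C) :
  nbhs x W <-> exists2 e : R, 0 < e & forall y, nc (y - x) < e -> W y.
Proof.
split.
  move=> /nbhs_ballP[e /= /gtC_rc[r r0 ->] h]; exists r => // y hy; apply: h.
  by rewrite -ball_normE /ball_ /= distrC normcC ltcR.
move=> [r r0 h]; apply/nbhs_ballP; exists (rc r) => /=; first by rewrite ltcR.
by move=> y; rewrite -ball_normE /ball_ /= distrC normcC ltcR; exact: h.
Qed.

Lemma nbhs_opnorm n (A : 'M[C]_n) (W : set 'M[C]_n) :
  nbhs A W <-> exists2 e : R, 0 < e & forall B, opnorm (B - A) < e -> W B.
Proof.
split.
  move=> /nbhs_ballP[e /= e0 h]; have [r r0 er] := gtC_rc e0.
  exists r => // B hB; apply: h; split=> // i j.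
  rewrite er -ball_normE /ball_ /= distrC normcC ltcR.
  apply: le_lt_trans hB; have := opnorm_entry (B - A) i j.
  by rewrite !mxE.
(* Each of the [n * n] entries may move by [r / k]; the extra 1 makes the total strictly smaller
   than [r] and keeps [k] nonzero for [n = 0]. *)
move=> [r r0 h]; pose k : R := (n * n)%:R + 1.
have k0 : 0 < k by rewrite ltr_wpDl.
apply/nbhs_ballP; exists (rc (r / k)) => /=; first by rewrite ltcR divr_gt0.
move=> B [_ hB]; apply: h; apply: le_lt_trans (opnorm_le_absum _) _.
have hs : absum (B - A) <= \sum_(i < n) \sum_(j < n) (r / k).
  apply: ler_sum => i _; apply: ler_sum => j _; have := hB i j.
  by rewrite -ball_normE /ball_ /= distrC normcC ltcR !mxE => /ltW.
apply: le_lt_trans hs _.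
rewrite (eq_bigr (fun=> (r / k) *+ n)); last by move=> i _; rewrite sumr_const
  card_ord.
rewrite sumr_const card_ord -mulrnA -mulr_natr -mulrA gtr_pMr// mulrC.
by rewrite ltr_pdivrMr// mul1r ltrDl.
Qed.

Definition mxcvg (X : Type) (F : set_system X) n (f : X -> 'M[C]_n) (A : 'M[C]_n) :=
  forall e : R, 0 < e -> F [set x | opnorm (f x - A) < e].

Section Calculus.
Context (X : Type) (F : set_system X) {FF : Filter F}.

Lemma mxcvgP n (f : X -> 'M[C]_n) A : f @ F --> A <-> mxcvg F f A.
Proof.
split=> [h e e0|h W /nbhs_opnorm[e e0 hW]].
  have hn : nbhs A [set B | opnorm (B - A) < e].
    by apply/nbhs_opnorm; exists e.
  exact: (h _ hn).
exact: (@filterS X F FF _ (f @^-1` W) (fun x => hW (f x)) (h e e0)).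
Qed.

Lemma mxcvg_cst n (A : 'M[C]_n) : mxcvg F (fun=> A) A.
Proof.
move=> e e0; apply: (@filterS _ F _ setT); last exact: filterT.
by move=> x _ /=; rewrite subrr opnorm0.
Qed.

Lemma mxcvgD n (f g : X -> 'M[C]_n) A B :
  mxcvg F f A -> mxcvg F g B -> mxcvg F (fun x => f x + g x) (A + B).
Proof.
move=> hf hg e e0; have e2 : 0 < e / 2 by rewrite divr_gt0.
apply: filterS2 (hf _ e2) (hg _ e2) => x /= h1 h2.
rewrite opprD addrACA; apply: le_lt_trans (opnormD _ _) _.
by rewrite [ltRHS]splitr; exact: ltrD h1 h2.
Qed.

Lemma mxcvgZ n c (f : X -> 'M[C]_n) A :
  mxcvg F f A -> mxcvg F (fun x => c *: f x) (c *: A).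
Proof.
move=> hf e e0; have k0 : 0 < nc c + 1 by rewrite ltr_wpDl// nc_ge0.
apply: filterS (hf (e / (nc c + 1)) _); last by rewrite divr_gt0.
move=> x /= h; rewrite -scalerBr; apply: le_lt_trans (opnormZ_le _ _) _.
have : nc c * opnorm (f x - A) <= nc c * (e / (nc c + 1)).
  by rewrite ler_wpM2l ?nc_ge0// ltW.
move=> /le_lt_trans; apply; rewrite mulrA ltr_pdivrMr// mulrC ltr_pM2l//.
by rewrite ltrDl.
Qed.

Let product_bound (a b d u v : R) : 0 <= a -> 0 <= b -> 0 <= u -> 0 <= v ->
  a < d -> b < d -> d <= 1 -> a * b + a * v + u * b < d * (u + v + 1).
Proof.
move=> a0 b0 u0 v0 ad bd d1.
have h1 : a * b <= a by rewrite ler_piMr// (le_trans (ltW bd)).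
have h2 : a * v <= d * v by rewrite ler_wpM2r// ltW.
have h3 : u * b <= u * d by rewrite ler_wpM2l// ltW.
lra.
Qed.

Lemma mxcvgM n (f g : X -> 'M[C]_n) A B :
  mxcvg F f A -> mxcvg F g B -> mxcvg F (fun x => f x *m g x) (A *m B).
Proof.
move=> hf hg e e0; pose k := opnorm A + opnorm B + 1.
have k0 : 0 < k by rewrite ltr_wpDl// addr_ge0 ?opnorm_ge0.
(* As [d <= 1], the product of the two errors is again below [d], and the three error terms together
   stay below [d * k]. *)
pose d := Num.min 1 (e / k).
have d0 : 0 < d by rewrite lt_min ltr01 divr_gt0.
have d1 : d <= 1 by rewrite ge_min lexx.
have de : d * k <= e by rewrite -ler_pdivlMr// ge_min lexx orbT.
apply: filterS2 (hf _ d0) (hg _ d0) => x /= h1 h2.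
have -> : f x *m g x - A *m B = (f x - A) *m (g x - B) + (f x - A) *m B + A *m
  (g x - B).
  by rewrite -mulmxDr subrK mulmxBl mulmxBr addrA subrK.
have A0 := opnorm_ge0 A; have B0 := opnorm_ge0 B.
apply: le_lt_trans (opnormD _ _) _; apply: le_lt_trans (lerD (opnormD _ _) (lexx
  _)) _.
apply: le_lt_trans (lerD (lerD (opnormM _ _) (opnormM _ _)) (opnormM _ _)) _.
have hb := product_bound (opnorm_ge0 (f x - A)) (opnorm_ge0 (g x - B))
  (opnorm_ge0 A) (opnorm_ge0 B) h1 h2 d1.
exact: lt_le_trans hb de.
Qed.

Lemma mxcvg_adj n (f : X -> 'M[C]_n) A :
  mxcvg F f A -> mxcvg F (fun x => (f x)^t*) (A^t*).
Proof.
move=> hf e e0; apply: filterS (hf e e0) => x /=; apply: le_lt_trans.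
by rewrite -map_mxB -linearB; exact: opnorm_adj.
Qed.

Lemma mxcvg_dsum n k (f : X -> 'M[C]_n) (g : X -> 'M[C]_k) A B :
  mxcvg F f A -> mxcvg F g B ->
  mxcvg F (fun x => mxdsum (f x) (g x)) (mxdsum A B).
Proof.
move=> hf hg e e0; have e2 : 0 < e / 2 by rewrite divr_gt0.
apply: filterS2 (hf _ e2) (hg _ e2) => x /= h1 h2.
rewrite -scaleN1r mxdsumZ !scaleN1r mxdsumD.
apply: (@le_lt_trans _ _ (e / 2)); last by rewrite gtr_pMr// invf_lt1// ltr1n.
exact: opnorm_dsum (ltW h1) (ltW h2).
Qed.

End Calculus.

Lemma opnorm_continuous n : continuous (@opnorm R n).
Proof.
move=> A W /nbhs_ballP[e /= e0 hW]; apply/nbhs_opnorm; exists e => // B hB.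
apply: hW; rewrite -ball_normE /ball_ /= distrC.
exact: le_lt_trans (opnorm_dist _ _) hB.
Qed.

Lemma complex_continuous : continuous (fun z : R * R => (z.1 +i* z.2)%C : C).
Proof.
move=> [a b] W /nbhs_nc[e e0 hW].
have e2 : 0 < e / 2 by rewrite divr_gt0.
exists (ball a (e / 2), ball b (e / 2)); first by split; exact: nbhsx_ballx.
move=> [c d] [/= h1 h2]; apply: hW.
have -> : (c +i* d)%C - (a +i* b)%C = rc (c - a) + 'i%C * rc (d - b) :> C.
  by rewrite /rc; simpc.
apply: le_lt_trans (ncD _ _) _; rewrite ncM [ltRHS]splitr.
have nci : nc 'i%C = 1 by rewrite /= expr0n expr1n add0r sqrtr1.
have ncr (t : R) : nc (rc t) = `|t| by rewrite /rc /= expr0n addr0 sqrtr_sqr.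
rewrite nci mul1r !ncr; move: h1 h2; rewrite /ball /= => h1 h2.
by apply: ltrD; rewrite distrC.
Qed.

Lemma compact_disc (r : R) : compact [set c : C | nc c <= r].
Proof.
pose f (z : R * R) : C := (z.1 +i* z.2)%C.
have cK : compact (f @` (`[- r, r] `*` `[- r, r])).
  apply: continuous_compact; first exact/continuous_subspaceT/complex_continuous.
  by apply: compact_setX; exact: segment_compact.
have cl : closed [set c : C | nc c <= r].
  move=> c hc; rewrite /= leNgt; apply/negP => rc0.
  have [|b [/= hb1 hb2]] := hc [set b | nc (b - c) < nc c - r].
    by apply/nbhs_nc; exists (nc c - r) => //; rewrite subr_gt0.
  have := ncD (c - b) b; rewrite subrK -(ncN (c - b)) opprB; lra.
apply: (subclosed_compact cl cK) => -[a b] /= h; exists (a, b) => //=.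
have hab : a ^+ 2 + b ^+ 2 <= r ^+ 2.
  have r0 : 0 <= r := le_trans (sqrtr_ge0 _) h.
  by rewrite -(@sqr_sqrtr _ (a ^+ 2 + b ^+ 2)) ?addr_ge0 ?sqr_ge0// ler_pXn2r//
    nnegrE ?sqrtr_ge0.
have r0 : 0 <= r := le_trans (sqrtr_ge0 _) h.
by split; rewrite /= in_itv /= -ler_norml -(@ler_pXn2r _ 2)// ?nnegrE//
  real_normK ?num_real//;
  apply: le_trans hab; rewrite ?lerDl ?lerDr sqr_ge0.
Qed.

(** Tychonoff's theorem for row vectors, carried over along [vec_mx]. *)
Lemma compact_mx_entries n (r : R) :
  compact [set A : 'M[C]_n | forall i j, nc (A i j) <= r].
Proof.
have cv : continuous (vec_mx : 'rV[C]_(n * n) -> 'M[C]_n).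
  move=> v W [P hP hW].
  exists (fun i k => [set c | forall a b, k = mxvec_index a b -> P a b c]).
    move=> i k; rewrite (ord1 i); case/mxvec_indexP: k => a b.
    have := hP a b; rewrite mxE; apply: filterS => c hc a' b'.
    have inj : injective (uncurry (@mxvec_index n n)).
      have [g /(_ _ (erefl _))] := curry_mxvec_bij n n.
      by move=> gK _; apply: (can_inj (g := g)) => z; exact: gK.
    by move=> /(inj (a, b) (a', b'))[<- <-].
  by move=> w hw; apply: hW => a b; rewrite mxE; exact: hw.
have cK := rV_compact (fun _ : 'I_(n * n) => @compact_disc r).
have : compact (vec_mx @` [set v : 'rV[C]_(n * n) | forall i, nc (v ord0 i) <= r]).
  by apply: continuous_compact => //; exact: continuous_subspaceT.
congr compact; apply/seteqP; split=> [_ [v hv <-] i j|A hA]; first by rewrite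
  mxE; exact: hv.
exists (mxvec A); rewrite ?mxvecK// => k /=.
by case/mxvec_indexP: k => a b; rewrite mxvecE.
Qed.

Lemma closed_opnorm_le n (X : topologicalType) (f : X -> 'M[C]_n) (r : R) :
  continuous f -> closed [set x | opnorm (f x) <= r].
Proof.
move=> cf; have /continuous_closedP h : continuous (fun x => opnorm (f x)).
  by move=> x; apply: continuous_comp; [exact: cf|exact: opnorm_continuous].
exact: (h [set t | t <= r] (@closed_le R r)).
Qed.

Lemma mx_continuous_id n : continuous (id : 'M[C]_n -> 'M[C]_n).
Proof. by move=> x; exact: cvg_id. Qed.

Lemma compact_opball n (r : R) : compact [set A : 'M[C]_n | opnorm A <= r].
Proof.
apply: (subclosed_compact _ (@compact_mx_entries n r)).
  exact: (closed_opnorm_le (@mx_continuous_id n)).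
by move=> A hA i j; exact: le_trans (opnorm_entry _ _ _) hA.
Qed.

Lemma compact_unitary n : compact [set U : 'M[C]_n | U \is unitarymx].
Proof.
apply: (subclosed_compact _ (@compact_opball n 1)); last first.
  by move=> U; exact: opnorm_unitary.
have -> : [set U : 'M[C]_n | U \is unitarymx] = [set U | opnorm (U *m U^t* -
  1%:M) <= 0].
  apply/seteqP; split=> U /=; first by move=> hU; rewrite unitary_Madj// subrr
    opnorm0.
  move=> h; apply/unitarymxP/eqP; rewrite -subr_eq0; apply/eqP/matrixP => i j.
  rewrite [RHS]mxE; apply: Normc.eq0_normc; apply/le_anti; rewrite nc_ge0 andbT.
  exact: le_trans (opnorm_entry _ _ _) h.
apply: closed_opnorm_le => U.
have FU : Filter (nbhs U) by exact: nbhs_filter.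
have cU : mxcvg (nbhs U) id U by apply/mxcvgP; exact: cvg_id.
apply/mxcvgP; exact: (mxcvgD (mxcvgM cU (mxcvg_adj cU)) (mxcvg_cst (- 1%:M))).
Qed.

End MatrixTopology.

(** * Tietze's theorem for property (sigma) *)

Section SigmaTietze.
Variables (R : realType) (X : topologicalType).
Hypothesis hX : hausdorff_space X.

(** Points outside [K] are isolated in [subspace K], so any set of them is open. Only the parts
    inside [K] have to be separated, and there compactness does it. *)
Lemma normal_compact_subspace (K : set X) :
  compact K -> normal_space (subspace K).
Proof.
move=> cK; apply/(@normal_openP R) => A B cA cB AB0.
have hK : hausdorff_space (subspace K) by exact: subspace_hausdorff.
have oK : open (K : set (subspace K)) by exact: open_subspaceT.
have clK : closed (K : set (subspace K)) by exact: closed_subspaceT.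
have cK' : compact (K : set (subspace K)).
  have [_] := @compact_subspaceIP X K K; rewrite setIid; exact.
have cAK : closed (A `&` K : set (subspace K)) by exact: closedI.
have AKK : (A `&` K : set (subspace K)) `<=` (K : set (subspace K))°.
  by move=> x [_ Kx]; exact: open_nbhs_nbhs.
have nb : set_nbhs (A `&` K : set (subspace K)) (~` B).
  move=> x [Ax _]; apply: open_nbhs_nbhs; split; first exact: closed_openC.
  by move=> Bx; have : (A `&` B) x by []; rewrite AB0.
have [D /set_nbhsP[D' [oD' AD' D'D]] hDB] := compact_normal_local hK cK' AKK cAK nb.
have oAK : open (A `\` K : set (subspace K)).
  by apply: open_subspace_out; move=> x [].
have cAK' : closed (A `\` K : set (subspace K)).
  rewrite setDE; apply: closedI => //; exact: open_closedC.
exists (D' `|` (A `\` K)), (~` closure D `&` ~` (A `\` K)); split.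
- exact: openU.
- by apply: openI; apply: closed_openC => //; exact: closed_closure.
- move=> x Ax; have [Kx|nKx] := EM (K x); last by right.
  by left; exact: AD'.
- move=> x Bx; split; first by move=> /hDB.
  by move=> [Ax _]; have : (A `&` B) x by []; rewrite AB0.
- rewrite -subset0 => x [[D'x|AKx] [nD nA]]; last exact: nA.
  by apply: nD; apply: subset_closure; exact: D'D.
Qed.

Hypothesis sX : property_sigma X.

(** The function is extended over [K n], one [n] at a time, always keeping its values on [Z]. The
    limit is continuous because closedness is tested on each [K n], where the sequence of extensions
    is eventually constant. *)
Lemma tietze_sigma (Z : set X) (f : X -> R) (M : R) :
  closed Z -> 0 < M -> {within Z, continuous f} ->
  (forall x, Z x -> `|f x| <= M) ->
  exists g : X -> R, [/\ continuous g, forall x, Z x -> g x = f x &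
    forall x, `|g x| <= M].
Proof.
move=> cZ M0 cf fM; have [K [Kmono Kcov Kc Kcl]] := sX.
have Kclosed n : closed (K n) by apply: compact_closed => //; case: (Kc n).
(* The invariant is a premise under the existential, so that [choice] yields a total step
   function. *)
have step n (g : X -> R) : exists g' : X -> R,
  {within K n, continuous g} /\ (forall x, `|g x| <= M) /\
  (forall x, K n x -> Z x -> g x = f x) ->
  ({within K n.+1, continuous g'} /\ (forall x, `|g' x| <= M) /\
  (forall x, K n.+1 x -> Z x -> g' x = f x)) /\ (forall x, K n x -> g' x = g x).
  have [[cg [gM gZ]]|] := EM ({within K n, continuous g} /\ (forall x, `|g x| <=
    M) /\
    (forall x, K n x -> Z x -> g x = f x)); last by exists g.
  (* The invariant makes [g] and [f] agree where [K n] meets [Z], so they glue along two closed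
     sets. *)
  pose h x := if x \in K n then g x else f x.
  have hK x : K n x -> h x = g x by move=> Kx; rewrite /h mem_set.
  have hZ x : Z x -> h x = f x.
    by move=> Zx; rewrite /h; case: ifPn => // /set_mem Kx; exact: gZ.
  have ch : {within K n `|` Z, continuous h}.
    apply: withinU_continuous => //.
      by apply: subspace_eq_continuous cg => x /set_mem Kx; exact/esym/hK.
    by apply: subspace_eq_continuous cf => x /set_mem Zx; exact/esym/hZ.
  have nK := @normal_compact_subspace (K n.+1) (Kc n.+1).1.
  pose D : set (subspace (K n.+1)) := K n `|` Z.
  have cD : closed D by apply: closed_subspaceW; exact: closedU.
  have cD' : {within D, continuous (h : subspace (K n.+1) -> R^o)}.
    apply/continuous_closedP => W cW.
    have /continuous_closedP/(_ W cW)/closed_subspaceP[V cV VW] := ch.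
    apply/closed_subspaceP; exists V => //; exact: closed_subspaceW.
  have hM x : D x -> `|h x| <= M.
    by move=> [Kx|Zx]; [rewrite hK|rewrite hZ//; exact: fM].
  have [g' [g'h cg' g'M]] := continuous_bounded_extension nK cD M0 cD' hM.
  exists g' => _; split; last first.
    by move=> x Kx; rewrite -(g'h x) ?hK// inE; left.
  split=> //; split=> // x _ Zx.
  by rewrite -(g'h x) ?hZ// inE; right.
have [next nextP] := choice (fun ng : nat * (X -> R) => step ng.1 ng.2).
have [g0 [cg0 [g0M g0Z]]] : exists g : X -> R,
    {within K 0%N, continuous g} /\ (forall x, `|g x| <= M) /\
    (forall x, K 0%N x -> Z x -> g x = f x).
  have nK := @normal_compact_subspace (K 0%N) (Kc 0%N).1.
  have cD : closed (Z : set (subspace (K 0%N))) by exact: closed_subspaceW.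
  have cD' : {within (Z : set (subspace (K 0%N))),
      continuous (f : subspace (K 0%N) -> R^o)}.
    apply/continuous_closedP => W cW.
    have /continuous_closedP/(_ W cW)/closed_subspaceP[V cV VW] := cf.
    apply/closed_subspaceP; exists V => //; exact: closed_subspaceW.
  have [g [gf cg gM]] := continuous_bounded_extension nK cD M0 cD' fM.
  by exists g; split=> //; split=> // x _ Zx; rewrite (gf x)// inE.
pose G := fix G n := if n is n'.+1 then next (n', G n') else g0.
have GP n : {within K n, continuous (G n)} /\ (forall x, `|G n x| <= M) /\
    (forall x, K n x -> Z x -> G n x = f x).
  elim: n => [//|n IH]; exact: (nextP (n, G n) IH).1.
have GS n x : K n x -> G n.+1 x = G n x by exact: (nextP (n, G n) (GP n)).2.
have Kle n m : (n <= m)%N -> K n `<=` K m.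
  move=> /subnK <-; elim: (m - n)%N => [//|k IH]; rewrite addSn.
  exact: subset_trans IH (Kmono _).
have Gle n m x : (n <= m)%N -> K n x -> G m x = G n x.
  move=> /subnK <- Kx; elim: (m - n)%N => [//|k IH]; rewrite addSn GS//.
  by apply: Kle Kx; rewrite leq_addl.
have ex x : exists n, K n x.
  by have : [set: X] x by []; rewrite -Kcov => -[n _ Kn]; exists n.
have [N hN] := choice ex.
pose g x := G (N x) x.
have gG n x : K n x -> g x = G n x.
  move=> Kx; rewrite /g; have [le|/ltnW le] := leqP n (N x).
    exact: Gle.
  by rewrite (Gle _ _ _ le (hN x)).
exists g; split.
- apply/continuous_closedP => W cW; apply/Kcl => n.
  have /continuous_closedP/(_ W cW)/closed_subspaceP[V cV VW] := (GP n).1.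
  have -> : g @^-1` W `&` K n = V `&` K n.
    rewrite VW; apply/seteqP; split=> x /= [h Kx]; split=> //.
      by change (W (G n x)); rewrite -(gG n x Kx).
    by change (W (g x)); rewrite (gG n x Kx).
  exact: closedI.
- by move=> x Zx; have [_ [_ h]] := GP (N x); exact: h.
- by move=> x; have [_ [h _]] := GP (N x); exact: h.
Qed.

End SigmaTietze.

(** * The Frobenius norm *)

Section Frobenius.
Variable R : realType.
Local Notation C := (Cplx R).
Local Notation nc := (@Normc.normc R).

Lemma l2norm_parallelogram n (u v : 'cV[C]_n) :
  l2norm (u + v) ^+ 2 + l2norm (u - v) ^+ 2 = 2 * l2norm u ^+ 2 + 2 * l2norm v ^+ 2.
Proof.
apply: rc_inj; rewrite !mulr_natl !mulr2n !rcD -!hdot_l2norm.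
rewrite hdotDl hdotBl !hdotBr.
have e w : hdot w (u + v) = hdot w u + hdot w v.
  by rewrite /hdot linearD /= map_mxD mulmxDl mxE.
by rewrite !e; ring.
Qed.

(** Unlike the operator norm it obeys the parallelogram law, and it is still invariant under unitary
    conjugation. *)
Definition frob n (A : 'M[C]_n) : R := l2norm (mxvec A)^T.

Lemma frob_ge0 n (A : 'M[C]_n) : 0 <= frob A. Proof. exact: l2norm_ge0. Qed.

Lemma frobD n (A B : 'M[C]_n) : frob (A + B) <= frob A + frob B.
Proof. by rewrite /frob !linearD; exact: l2normD. Qed.

Lemma frobN n (A : 'M[C]_n) : frob (- A) = frob A.
Proof. by rewrite /frob -scaleN1r !linearZ l2normZ ncN Normc.normc1 mul1r. Qed.

Lemma frob0 n : frob (0 : 'M[C]_n) = 0.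
Proof. by rewrite /frob !linear0 l2norm0. Qed.

Lemma frobZ n (c : C) (A : 'M[C]_n) : frob (c *: A) = nc c * frob A.
Proof. by rewrite /frob !linearZ l2normZ. Qed.

Lemma frob_eq0 n (A : 'M[C]_n) : frob A = 0 -> A = 0.
Proof.
move=> /l2norm_eq0 h; apply/eqP; rewrite -mxvec_eq0; apply/eqP.
by rewrite -(trmxK (mxvec A)) h trmx0.
Qed.

Lemma frob_parallelogram n (A B : 'M[C]_n) :
  frob (A + B) ^+ 2 + frob (A - B) ^+ 2 = 2 * frob A ^+ 2 + 2 * frob B ^+ 2.
Proof. by rewrite /frob !(linearB, linearD); exact: l2norm_parallelogram. Qed.

Lemma frob_entry n (A : 'M[C]_n) i j : nc (A i j) <= frob A.
Proof.
have := l2norm_entry (mxvec A)^T (mxvec_index i j).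
by rewrite mxE mxvecE.
Qed.

Lemma absum_le n (A : 'M[C]_n) (c : R) :
  (forall i j, nc (A i j) <= c) -> absum A <= (n * n)%:R * c.
Proof.
move=> h; have : absum A <= \sum_(i < n) \sum_(j < n) c.
  by apply: ler_sum => i _; apply: ler_sum => j _.
rewrite (eq_bigr (fun=> c *+ n)); last by move=> i _; rewrite sumr_const card_ord.
by rewrite sumr_const card_ord -mulrnA mulr_natl.
Qed.

Lemma sum_mxvec n (F : 'I_(n * n) -> R) :
  \sum_k F k = \sum_i \sum_j F (mxvec_index i j).
Proof.
rewrite pair_bigA /= (reindex (uncurry (@mxvec_index n n))) /=.
  by apply: eq_bigr => -[i j].
exact: curry_mxvec_bij.
Qed.

Lemma frob_le_absum n (A : 'M[C]_n) : frob A <= absum A.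
Proof.
apply: le_trans (l2norm_le_sum _) _; rewrite sum_mxvec.
by apply: ler_sum => i _; apply: ler_sum => j _; rewrite mxE mxvecE.
Qed.

Lemma frob_le_opnorm n (A : 'M[C]_n) : frob A <= (n * n)%:R * opnorm A.
Proof.
by apply: le_trans (frob_le_absum _) _; apply: absum_le => i j; exact: opnorm_entry.
Qed.

Lemma opnorm_le_frob n (A : 'M[C]_n) : opnorm A <= (n * n)%:R * frob A.
Proof.
by apply: le_trans (opnorm_le_absum _) _; apply: absum_le => i j; exact: frob_entry.
Qed.

Lemma frob_trace n (A : 'M[C]_n) : rc (frob A ^+ 2) = \tr (A^t* *m A).
Proof.
rewrite l2norm_sqr rc_sum.
transitivity (\sum_k `|mxvec A 0 k| ^+ 2).
  by apply: eq_bigr => k _; rewrite mxE rcX -normcC.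
transitivity (\sum_i \sum_j `|A i j| ^+ 2).
  rewrite pair_bigA /= (reindex (uncurry (@mxvec_index n n))) /=.
    by apply: eq_bigr => -[i j] _; rewrite mxvecE.
  exact: curry_mxvec_bij.
rewrite exchange_big /mxtrace; apply: eq_bigr => j _; rewrite mxE.
by apply: eq_bigr => i _; rewrite !mxE normCK mulrC.
Qed.

Lemma frob_conj n (U A : 'M[C]_n) : U \is unitarymx -> frob (U *m A *m U^t*) =
  frob A.
Proof.
move=> hU; apply/eqP; rewrite -(@eqrXn2 _ 2)// ?frob_ge0//; apply/eqP/rc_inj.
rewrite 2!frob_trace; have -> : (U *m A *m U^t*)^t* = U *m A^t* *m U^t*.
  by rewrite 2!adjM trmxCK mulmxA.
have -> : U *m A^t* *m U^t* *m (U *m A *m U^t*) = U *m (A^t* *m A *m U^t*).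
  by rewrite !mulmxA -[_ *m U^t* *m U]mulmxA (unitary_adjM hU) mulmx1.
by rewrite mxtrace_mulC -[_ *m U^t* *m U]mulmxA (unitary_adjM hU) mulmx1.
Qed.

Lemma frob_conjV n (U A : 'M[C]_n) : U \is unitarymx -> frob (U^t* *m A *m U) =
  frob A.
Proof.
move=> hU; have := frob_conj A (adj_unitary hU).
by rewrite trmxCK.
Qed.

End Frobenius.

(** * Equivariant extension *)

Section EquivariantExtension.
Variables (R : realType) (T : tower R).
Local Notation C := (Cplx R).
Local Notation nc := (@Normc.normc R).

Lemma near_tdim (x : T) : \forall y \near x, tdim y = tdim x.
Proof. exact: (@tdim_continuous R T x [set tdim x]). Qed.

Lemma closed_tdim n : closed [set x : T | tdim x = n].
Proof.
move=> x hx; have [y [hy yx]] := hx _ (near_tdim x).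
by rewrite /= -yx.
Qed.

Lemma near_tact n (U : 'M[C]_n) (x : T) (W : set T) :
  U \is unitarymx -> tdim x = n -> nbhs (tact U x) W ->
  \forall V \near U & y \near x, V \is unitarymx -> tdim y = n -> W (tact V y).
Proof.
move=> hU hx hW; have /subspace_continuousP h := @tact_continuous R T n.
have := h (U, x) (conj hU hx) W hW.
rewrite /= => -[[A B] [hA hB] hAB]; exists (A, B) => //= -[V y] [/= AV By] hV hy.
by have := hAB (V, y) (conj AV By); apply; split.
Qed.

(** Tube lemma: compactness of the unitary group gives one neighbourhood of [x] that works for all
    [U]. *)
Lemma compact_unitary_near n (x : T) (P : 'M[C]_n -> T -> Prop) :
  (forall U, U \is unitarymx -> \forall V \near U & y \near x, V \is unitarymx
    -> P V y) ->
  \forall y \near x, forall U, U \is unitarymx -> P U y.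
Proof.
have /compact_near_coveringP/near_covering_withinP cU := @compact_unitary R n.
move=> h; have Fx : Filter (nbhs x) by exact: nbhs_filter.
exact: (cU T (nbhs x) (fun y V => P V y) Fx h).
Qed.

(** Tietze's theorem for the real and imaginary part of each entry, both bounded by 1; the modulus
    is then at most the square root of 2, whence the bound 2. *)
Lemma scalar_field_extension n (Z : set T) (G : T -> 'M[C]_n) :
  property_sigma T -> closed Z ->
  (forall x, Z x -> mxcvg (within Z (nbhs x)) G (G x)) ->
  (forall x, Z x -> opnorm (G x) <= 1) ->
  exists h : T -> 'M[C]_n, [/\ forall x, mxcvg (nbhs x) h (h x),
    forall x, Z x -> h x = G x & forall x i j, nc (h x i j) <= 2].
Proof.
move=> sT cZ cG G1.
have hT := tower_hausdorff (t := T).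
have ext (p : C -> R) (i j : 'I_n) : (forall a b, `|p a - p b| <= nc (a - b)) ->
    (forall a, `|p a| <= nc a) ->
    exists g : T -> R, [/\ continuous g, forall x, Z x -> g x = p (G x i j) &
    forall x, `|g x| <= 1].
  move=> plip pnc; apply: (tietze_sigma hT sT cZ ltr01); last first.
    move=> x Zx; apply: le_trans (pnc _) _; apply: le_trans (opnorm_entry _ _ _) _.
    exact: G1.
  apply/subspace_continuousP => x Zx W /nbhs_ballP[e /= e0 hW].
  have := cG x Zx e e0; apply: filterS => y /= hy; apply: hW.
  rewrite -ball_normE /ball_ /= distrC; apply: le_lt_trans (plip _ _) _.
  apply: le_lt_trans hy; have := opnorm_entry (G y - G x) i j.
  by rewrite !mxE.
have Relip (a b : C) : `|complex.Re a - complex.Re b| <= nc (a - b).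
  have := normc_ge_Re (a - b); rewrite normcC rc_le.
  by case: a b => [a a'] [b b'].
have Renc (a : C) : `|complex.Re a| <= nc a.
  by have := normc_ge_Re a; rewrite normcC rc_le.
have Imnc (a : C) : `|complex.Im a| <= nc a.
  by case: a => a b /=; rewrite -sqrtr_sqr ler_wsqrtr// lerDr sqr_ge0.
have Imlip (a b : C) : `|complex.Im a - complex.Im b| <= nc (a - b).
  by apply: le_trans (Imnc (a - b)); case: a b => [a a'] [b b'].
have [gr hgr] := choice (fun ij : 'I_n * 'I_n => ext (@complex.Re R) ij.1 ij.2
  Relip Renc).
have [gi hgi] := choice (fun ij : 'I_n * 'I_n => ext (@complex.Im R) ij.1 ij.2
  Imlip Imnc).
pose h (x : T) : 'M[C]_n := \matrix_(i, j) ((gr (i, j) x +i* gi (i, j) x)%C : C).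
exists h; split=> [x|x Zx|x i j].
- have Fx : Filter (nbhs x) by exact: nbhs_filter.
  apply/mxcvgP => W [P hP hW].
  have hn i j : \forall y \near x, P i j (h y i j).
    have [cr _ _] := hgr (i, j); have [ci _ _] := hgi (i, j).
    have := hP i j; rewrite mxE => hPij.
    have := @complex_continuous R (gr (i, j) x, gi (i, j) x) _ hPij.
    move=> [[A B] [/= hA hB] hAB].
    have hAx : nbhs x (gr (i, j) @^-1` A) := cr x _ hA.
    have hBx : nbhs x (gi (i, j) @^-1` B) := ci x _ hB.
    by apply: filterS2 hAx hBx => y /= Ay By; rewrite mxE; exact: (hAB (_, _)).
  have : \forall y \near x, forall i j, P i j (h y i j).
    by apply: filter_forall => i; apply: filter_forall => j; exact: hn.
  by apply: filterS => y hy; exact: hW.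
- apply/matrixP => i j; rewrite mxE; have [_ -> // _] := hgr (i, j).
  by have [_ -> // _] := hgi (i, j); case: (G x i j).
- rewrite mxE; have [_ _ h1] := hgr (i, j); have [_ _ h2] := hgi (i, j).
  move: (h1 x) (h2 x) => {}h1 {}h2.
  rewrite -(@ler_pXn2r _ 2)// ?nnegrE ?nc_ge0//= sqr_sqrtr ?addr_ge0 ?sqr_ge0//.
  have a1 : gr (i, j) x ^+ 2 <= 1 by rewrite -[leRHS](expr1n _ 2) -real_normK
    ?num_real// ler_pXn2r ?nnegrE.
  have a2 : gi (i, j) x ^+ 2 <= 1 by rewrite -[leRHS](expr1n _ 2) -real_normK
    ?num_real// ler_pXn2r ?nnegrE.
  lra.
Qed.

End EquivariantExtension.

(** * Chebyshev centres of unitary orbits *)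

Section Centre.
Variables (R : realType) (T : tower R) (n : nat).
Local Notation C := (Cplx R).
Local Notation nc := (@Normc.normc R).
Variable h : T -> 'M[C]_n.
Hypothesis h_cont : forall x, mxcvg (nbhs x) h (h x).
Hypothesis h_bound : forall x i j, nc (h x i j) <= 2.

(** The value of [h] at another point of the orbit, brought back to [x]; it is [h x] for every [U]
    when [h] is equivariant there. *)
Definition twist (U : 'M[C]_n) (x : T) : 'M[C]_n := U^t* *m h (tact U x) *m U.

Definition radius (x : T) (c : 'M[C]_n) : R :=
  sup [set frob (c - twist U x) | U in [set U : 'M[C]_n | U \is unitarymx]].

Lemma radius_has_sup x c :
  has_sup [set frob (c - twist U x) | U in [set U : 'M[C]_n | U \is unitarymx]].
Proof.
split; first by exists (frob (c - twist 1%:M x)), 1%:M => //=; exact: unitarymx1.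
exists (frob c + (n * n)%:R * 2) => _ [U /= hU <-].
apply: le_trans (frobD _ _) _; rewrite frobN lerD2l /twist frob_conjV//.
by apply: le_trans (frob_le_absum _) _; exact: absum_le.
Qed.

Lemma radius_ub x c U : U \is unitarymx -> frob (c - twist U x) <= radius x c.
Proof.
by move=> hU; apply: sup_upper_bound; [exact: radius_has_sup|exists U].
Qed.

Lemma radius_le x c t :
  (forall U, U \is unitarymx -> frob (c - twist U x) <= t) -> radius x c <= t.
Proof.
move=> ht; apply: ge_sup; first exact: (radius_has_sup x c).1.
by move=> _ [U /= hU <-]; exact: ht.
Qed.

Lemma radius_ge0 x c : 0 <= radius x c.
Proof. exact: le_trans (frob_ge0 _) (radius_ub x c (unitarymx1 R n)). Qed.

Lemma radius_lip x y c c' t : 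
  (forall U, U \is unitarymx -> frob (twist U y - twist U x) <= t) ->
  radius x c' <= radius y c + frob (c' - c) + t.
Proof.
move=> ht; apply: radius_le => U hU.
have -> : c' - twist U x = (c - twist U y) + (c' - c) + (twist U y - twist U x).
  have -> : c - twist U y + (c' - c) = c' - twist U y by rewrite addrC addrA subrK.
  by rewrite addrA subrK.
apply: le_trans (frobD _ _) _; apply: lerD; last exact: ht.
by apply: le_trans (frobD _ _) _; rewrite lerD2r; exact: radius_ub.
Qed.

Lemma radius_lipr x c c' : radius x c' <= radius x c + frob (c' - c).
Proof.
rewrite -[leRHS]addr0; apply: radius_lip => U _.
by rewrite subrr frob0.
Qed.

Lemma radius_continuous x : continuous (radius x).
Proof.
move=> c W /nbhs_ballP[e /= e0 hW]; apply/nbhs_opnorm.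
pose k : R := (n * n)%:R + 1; have k0 : 0 < k by rewrite ltr_wpDl.
exists (e / k); first by rewrite divr_gt0.
move=> B hB; apply: hW; rewrite -ball_normE /ball_ /=.
have h1 := radius_lipr x c B; have h2 := radius_lipr x B c.
rewrite -frobN opprB in h2.
have h3 := frob_le_opnorm (B - c).
have h4 : (n * n)%:R * opnorm (B - c) <= k * opnorm (B - c).
  by rewrite ler_wpM2r ?opnorm_ge0// lerDl.
have h5 : k * opnorm (B - c) < e by rewrite mulrC -ltr_pdivlMr.
rewrite ltr_norml; apply/andP; split; lra.
Qed.

(** Minimising over the unit ball of the operator norm, which is compact and invariant under unitary
    conjugation, keeps the extended field bounded by 1. *)
Definition is_centre x c := opnorm c <= 1 /\
  forall c', opnorm c' <= 1 -> radius x c <= radius x c'.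

Lemma centre_exists x : exists c, is_centre x c.
Proof.
have [||c] := @compact_EVT_min _ R (radius x) [set c | opnorm c <= 1] _
  (@compact_opball R n 1).
- by exists 0; rewrite /= opnorm0.
- exact: continuous_subspaceT (@radius_continuous x).
move=> /set_mem hc hmin; exists c; split; first exact: hc.
by move=> c' hc'; apply: hmin; exact: mem_set.
Qed.

Let midpoint_bound (p q r w t : R) :
  w + r = 2 * p + 2 * q -> p <= t -> q <= t -> (1 / 2) ^+ 2 * w <= t - r / 4.
Proof. lra. Qed.

Let quarter_bound (m r t : R) : m <= t - r / 4 -> r <= 4 * (t - m).
Proof. lra. Qed.

Let step_bound (a b c d m : R) :
  a <= b + d -> b <= c -> c <= m + d -> a <= m + 2 * d.
Proof. lra. Qed.

(** The left side equals [16 * d * (m + d)], at most [16 * d * (m + 1)]; doubling the constant makes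
    the inequality strict. *)
Let square_bound (d m : R) : 0 <= m -> 0 < d -> d <= 1 ->
  4 * ((m + 2 * d) ^+ 2 - m ^+ 2) < d * (32 * (m + 1)).
Proof. by move=> m0 d0 d1; nra. Qed.

(* Parallelogram law: the midpoint of two near-minimisers would beat the
   minimum if they were far apart. *)
Lemma centre_stable x c c' t : is_centre x c -> opnorm c' <= 1 ->
  radius x c' <= t -> frob (c' - c) ^+ 2 <= 4 * (t ^+ 2 - radius x c ^+ 2).
Proof.
move=> [c1 cmin] c'1 ht; have htc := le_trans (cmin _ c'1) ht.
have t0 : 0 <= t := le_trans (radius_ge0 _ _) ht.
pose half : C := rc (1 / 2).
have nch : nc half = 1 / 2 by rewrite nc_rc.
pose mid := half *: (c' + c).
have mid1 : opnorm mid <= 1.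
  apply: le_trans (opnormZ_le _ _) _; rewrite nch.
  have hcc := le_trans (opnormD c' c) (lerD c'1 c1).
  by rewrite mul1r ler_pdivrMl// mulr1.
have hh : half + half = 1 by rewrite -rcD -splitr.
have hw (A : 'M[C]_n) : half *: (A + A) = A by rewrite scalerDr -scalerDl hh
  scale1r.
have hm U : U \is unitarymx ->
    frob (mid - twist U x) ^+ 2 <= t ^+ 2 - frob (c' - c) ^+ 2 / 4.
  move=> hU; have a1 := le_trans (radius_ub x c' hU) ht.
  have a2 := le_trans (radius_ub x c hU) htc.
  have := frob_parallelogram (c' - twist U x) (c - twist U x).
  have -> : c' - twist U x - (c - twist U x) = c' - c by rewrite opprB addrA subrK.
  have -> : mid - twist U x = half *: (c' - twist U x + (c - twist U x)).
    by rewrite addrACA -opprD [RHS]scalerDr scalerN hw.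
  rewrite frobZ nch exprMn.
  have b1 : frob (c' - twist U x) ^+ 2 <= t ^+ 2 by rewrite ler_pXn2r ?nnegrE
    ?frob_ge0.
  have b2 : frob (c - twist U x) ^+ 2 <= t ^+ 2 by rewrite ler_pXn2r ?nnegrE
    ?frob_ge0.
  by move=> hp; exact: midpoint_bound hp b1 b2.
have r0 : 0 <= t ^+ 2 - frob (c' - c) ^+ 2 / 4.
  exact: le_trans (exprn_ge0 2 (frob_ge0 _)) (hm _ (unitarymx1 R n)).
have rmid : radius x mid <= Num.sqrt (t ^+ 2 - frob (c' - c) ^+ 2 / 4).
  apply: radius_le => U hU; rewrite -(ger0_norm (frob_ge0 (mid - twist U x))).
  by rewrite -sqrtr_sqr ler_wsqrtr// hm.
have : radius x c ^+ 2 <= t ^+ 2 - frob (c' - c) ^+ 2 / 4.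
  rewrite -(sqr_sqrtr r0) ler_pXn2r ?nnegrE ?radius_ge0 ?sqrtr_ge0//.
  exact: le_trans (cmin _ mid1) rmid.
exact: quarter_bound.
Qed.

Lemma centre_uniq x c c' : is_centre x c -> is_centre x c' -> c' = c.
Proof.
move=> hc [c'1 c'min]; have := centre_stable hc c'1 (c'min _ hc.1).
rewrite subrr mulr0 => h0; apply/eqP; rewrite -subr_eq0; apply/eqP/frob_eq0/eqP.
by rewrite -sqrf_eq0 eq_le h0 exprn_ge0// frob_ge0.
Qed.

(** The twists at [tact V x] are those at [x], reindexed by [U *m V] and conjugated by [V]. One
    inequality suffices, since it also applies to the adjoint of [V]. *)
Lemma radius_tact x c V : V \is unitarymx -> tdim x = n ->
  radius (tact V x) (V *m c *m V^t*) <= radius x c.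
Proof.
move=> hV hx; apply: radius_le => U hU.
have hUV := mul_unitarymx hU hV.
rewrite -(frob_conjV _ hV) mulmxBr mulmxBl.
have -> : V^t* *m (V *m c *m V^t*) *m V = c.
  by rewrite !mulmxA (unitary_adjM hV) mul1mx -mulmxA (unitary_adjM hV) mulmx1.
suff -> : V^t* *m twist U (tact V x) *m V = twist (U *m V) x by exact: radius_ub.
by rewrite /twist (tactM hU hV hx) adjM !mulmxA.
Qed.

Lemma centre_tact x c V : V \is unitarymx -> tdim x = n ->
  is_centre x c -> is_centre (tact V x) (V *m c *m V^t*).
Proof.
move=> hV hx [c1 cmin]; split; first by rewrite opnorm_conj.
move=> c' c'1; apply: le_trans (radius_tact c hV hx) _.
have hV' := adj_unitary hV.
have := radius_tact c' hV' (tdim_act hV hx); rewrite (tactK hV hx).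
by apply: le_trans; apply: cmin; rewrite opnorm_conj.
Qed.

(** Where the field is already equivariant the twists collapse to a single point of radius 0; hence
    taking centres preserves prescribed values. *)
Lemma centre_eq x c : opnorm c <= 1 ->
  (forall U, U \is unitarymx -> twist U x = c) -> is_centre x c.
Proof.
move=> c1 hc; split=> // c' _; apply: le_trans (radius_ge0 _ _).
by apply: radius_le => U hU; rewrite hc// subrr frob0.
Qed.

Lemma near_twist x d : tdim x = n -> 0 < d ->
  \forall y \near x, forall U, U \is unitarymx ->
    frob (twist U y - twist U x) <= d.
Proof.
move=> hx d0; pose k : R := (n * n)%:R + 1; have k0 : 0 < k by rewrite ltr_wpDl.
(* Half of the tolerance, since the values at [tact V y] and at [tact V x] are both compared with
   the one at [tact U x]; [k] dominates the factor between the two norms. *)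
pose e := d / k / 2; have e0 : 0 < e by rewrite !divr_gt0.
have near2 : \forall y \near x, forall U : 'M[C]_n, U \is unitarymx ->
    tdim y = n -> opnorm (h (tact U y) - h (tact U x)) < d / k.
  pose P (U : 'M[C]_n) (y : T) := tdim y = n ->
    opnorm (h (tact U y) - h (tact U x)) < d / k.
  suff hP : forall U, U \is unitarymx ->
      \forall V \near U & y \near x, V \is unitarymx -> P V y.
    exact: (compact_unitary_near hP).
  move=> U hU; have := near_tact hU hx (h_cont (tact U x) e0).
  move=> [[A B] [/= hA hB] hAB]; exists (A, B) => //= -[V y] [/= AV By] hV hy.
  have h1 := hAB (V, y) (conj AV By) hV hy.
  have h2 := hAB (V, x) (conj AV (nbhs_singleton hB)) hV hx.
  have -> : h (tact V y) - h (tact V x) =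
      (h (tact V y) - h (tact U x)) - (h (tact V x) - h (tact U x)).
    by rewrite opprB addrA subrK.
  apply: le_lt_trans (opnormB _ _) _; rewrite [ltRHS]splitr.
  exact: ltrD h1 h2.
have := near_tdim x; rewrite hx; apply: filterS2 near2 => y hU hy U' hU'.
have := hU U' hU' hy.
rewrite /twist -mulmxBl -mulmxBr frob_conjV// => hlt.
apply: le_trans (frob_le_opnorm _) _.
have : (n * n)%:R * opnorm (h (tact U' y) - h (tact U' x)) <= k * opnorm (h
  (tact U' y) - h (tact U' x)).
  by rewrite ler_wpM2r ?opnorm_ge0// lerDl.
move=> /le_trans; apply; rewrite mulrC -ler_pdivlMr//; exact: ltW.
Qed.

(** Passing from [x] to a nearby [y] changes every radius by at most [d], so the centre at [y] is
    nearly optimal at [x], and [centre_stable] puts it close to the centre at [x]. *)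
Lemma centre_continuous (H : T -> 'M[C]_n) x : tdim x = n ->
  (forall y, is_centre y (H y)) -> mxcvg (nbhs x) H (H x).
Proof.
move=> hx hH e e0; have Fx : Filter (nbhs x) by exact: nbhs_filter.
pose k : R := (n * n)%:R + 1; have k0 : 0 < k by rewrite ltr_wpDl.
pose m := radius x (H x); have m0 : 0 <= m by exact: radius_ge0.
pose u := e / k; have u0 : 0 < u by rewrite divr_gt0.
(* Chosen so that the bound of [centre_stable] at [t = m + 2 * d] falls below [u ^+ 2]. *)
pose d := Num.min 1 (u ^+ 2 / (32 * (m + 1))).
have m10 : 0 < 32 * (m + 1) by rewrite mulr_gt0// ltr_wpDl.
have d0 : 0 < d by rewrite lt_min ltr01 divr_gt0// exprn_gt0.
have d1 : d <= 1 by rewrite ge_min lexx.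
have du : d * (32 * (m + 1)) <= u ^+ 2 by rewrite -ler_pdivlMr// ge_min lexx orbT.
apply: filterS (near_twist hx d0) => y hy /=.
have hy' U : U \is unitarymx -> frob (twist U x - twist U y) <= d.
  by move=> hU; rewrite -frobN opprB; exact: hy.
have r1 : radius x (H y) <= radius y (H y) + d.
  by have := radius_lip (H y) (H y) hy; rewrite subrr frob0 addr0.
have r2 : radius y (H x) <= m + d.
  by have := radius_lip (H x) (H x) hy'; rewrite subrr frob0 addr0.
have r3 : radius y (H y) <= radius y (H x) := (hH y).2 _ (hH x).1.
have r4 : radius x (H y) <= m + 2 * d := step_bound r1 r3 r2.
have := centre_stable (hH x) (hH y).1 r4; rewrite -/m => hs.
have hs2 : frob (H y - H x) ^+ 2 < u ^+ 2.
  exact: le_lt_trans hs (lt_le_trans (square_bound m0 d0 d1) du).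
have hf : frob (H y - H x) < u.
  by move: hs2; rewrite ltr_pXn2r ?nnegrE ?frob_ge0// ltW.
apply: le_lt_trans (opnorm_le_frob _) _.
have : (n * n)%:R * frob (H y - H x) <= k * frob (H y - H x).
  by rewrite ler_wpM2r ?frob_ge0// lerDl.
by move=> /le_lt_trans; apply; rewrite mulrC -ltr_pdivlMr.
Qed.

End Centre.

Lemma equivariant_extension (R : realType) (T : tower R) n (Z : set T)
    (G : T -> 'M[Cplx R]_n) :
  property_sigma T -> closed Z ->
  (forall x, Z x -> tdim x = n) ->
  (forall x (U : 'M[Cplx R]_n), Z x -> U \is unitarymx -> Z (tact U x)) ->
  (forall x (U : 'M[Cplx R]_n), Z x -> U \is unitarymx -> G (tact U x) = U *m G
    x *m U^t*) ->
  (forall x, Z x -> mxcvg (within Z (nbhs x)) G (G x)) ->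
  (forall x, Z x -> opnorm (G x) <= 1) ->
  exists H : T -> 'M[Cplx R]_n,
    [/\ forall x, tdim x = n -> mxcvg (nbhs x) H (H x),
       forall x (U : 'M[Cplx R]_n), tdim x = n -> U \is unitarymx ->
         H (tact U x) = U *m H x *m U^t*,
       forall x, Z x -> H x = G x &
       forall x, opnorm (H x) <= 1].
Proof.
move=> sT cZ Zn ZU GU cG G1.
have [h [ch hG h2]] := scalar_field_extension sT cZ cG G1.
have [H hH] := choice (centre_exists h2); exists H; split.
- by move=> x hx; exact: (centre_continuous ch h2).
- move=> x U hx hU; 
  exact: (centre_uniq h2 (centre_tact h2 hU hx (hH x)) (hH (tact U x))).
- move=> x Zx; apply: (centre_uniq h2 _ (hH x)).
  apply: (centre_eq h2 (G1 x Zx)) => U hU.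
  rewrite /twist hG; last exact: ZU.
  by rewrite GU// !mulmxA (unitary_adjM hU) mul1mx -mulmxA (unitary_adjM hU) mulmx1.
- by move=> x; exact: (hH x).1.
Qed.

(** * Continuous fields *)

Section Gluing.
Variables (R : realType) (T : tower R).
Local Notation C := (Cplx R).
Implicit Types (x y z : T).

Lemma openP (X : topologicalType) (A : set X) :
  (forall p, A p -> nbhs p A) -> open A.
Proof. by move=> h; rewrite openE => p /h. Qed.

Lemma near_not_closed (X : topologicalType) (A : set X) p :
  closed A -> ~ A p -> \forall q \near p, ~ A q.
Proof. by move=> cA nA; apply: (open_nbhs_nbhs (conj (closed_openC cA) nA)). Qed.

Definition cont_at (G : T -> smx R) n x :=
  mxcvg (nbhs x) (fun y => mxof n (G y)) (mxof n (G x)).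

Definition sums (k l : nat) : set T :=
  [set z | exists a b, [/\ tdim a = k, tdim b = l & z = tsum a b]].

Lemma closed_sums_image k (D : set (T * T)) :
  closed D -> (forall p, D p -> tdim p.1 = k) ->
  closed [set tsum p.1 p.2 | p in D].
Proof.
move=> cD hD; have [_ _ h] := @tsum_closed_embedding R T k.
have := h D cD; congr closed; apply/seteqP; split=> [z [p [_ Dp] <-]|z [p Dp <-]].
  by exists p.
by exists p => //; split=> //; exact: hD.
Qed.

Lemma closed_tdim2 k l : closed [set p : T * T | tdim p.1 = k /\ tdim p.2 = l].
Proof.
have /continuous_closedP c1 : continuous (@fst T T) by move=> p; exact: cvg_fst.
have /continuous_closedP c2 : continuous (@snd T T) by move=> p; exact: cvg_snd.
exact: closedI (c1 _ (@closed_tdim R T k)) (c2 _ (@closed_tdim R T l)).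
Qed.

Lemma closed_sums k l : closed (sums k l).
Proof.
have := closed_sums_image (@closed_tdim2 k l) (fun p h => h.1).
congr closed; apply/seteqP; split=> [z [[a b] /= [ha hb] <-]|z [a [b [ha hb ->]]]].
  by exists a, b.
by exists (a, b).
Qed.

(** The pairs whose block sum is far from the value at [z] form a closed set. Its image under the
    closed map [tsum] is closed, and by additivity it misses [z], whichever way [z] is written as a
    sum. *)
Lemma sums_cont (G : T -> smx R) k l z e : sized G -> additive_field G ->
  (forall x, tdim x = k -> cont_at G k x) ->
  (forall x, tdim x = l -> cont_at G l x) ->
  sums k l z -> 0 < e ->
  \forall y \near z, sums k l y ->
    opnorm (mxof (k + l) (G y) - mxof (k + l) (G z)) < e.
Proof.
move=> sG aG ck cl [a [b [ha hb ez]]] e0.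
have Gsum a' b' : tdim a' = k -> tdim b' = l ->
    mxof (k + l) (G (tsum a' b')) = mxdsum (mxof k (G a')) (mxof l (G b')).
  move=> ha' hb'; rewrite aG -{1}(Smx_mxof (etrans (sG a') ha')).
  by rewrite -{1}(Smx_mxof (etrans (sG b') hb')) /smx_dsum /= mxof_Smx.
pose phi (p : T * T) := mxdsum (mxof k (G p.1)) (mxof l (G p.2)).
pose D := [set p : T * T | (tdim p.1 = k /\ tdim p.2 = l) /\
  ~ opnorm (phi p - phi (a, b)) < e].
have cD : closed D.
  rewrite -openC; apply: openP => p nD.
  have [[hp1 hp2]|nd] := EM (tdim p.1 = k /\ tdim p.2 = l); last first.
    have := near_not_closed (@closed_tdim2 k l) nd.
    by apply: filterS => q nq [].
  have hp : opnorm (phi p - phi (a, b)) < e by apply: contrapT => h; apply: nD.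
  have Fp : Filter (nbhs p) by exact: nbhs_filter.
  have c1 : mxcvg (nbhs p) (fun q => mxof k (G q.1)) (mxof k (G p.1)).
    move=> d d0; exists ([set y | opnorm (mxof k (G y) - mxof k (G p.1)) < d],
      setT).
      by split; [exact: (ck _ hp1 _ d0)|exact: filterT].
    by move=> q [h _]; exact: h.
  have c2 : mxcvg (nbhs p) (fun q => mxof l (G q.2)) (mxof l (G p.2)).
    move=> d d0; exists (setT, [set y | opnorm (mxof l (G y) - mxof l (G p.2)) <
      d]).
      by split; [exact: filterT|exact: (cl _ hp2 _ d0)].
    by move=> q [_ h]; exact: h.
  have d0 : 0 < e - opnorm (phi p - phi (a, b)) by rewrite subr_gt0.
  apply: (@filterS _ (nbhs p) Fp _ _ _ (mxcvg_dsum c1 c2 d0)) => q /= hq [_]; apply.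
  have -> : phi q - phi (a, b) = (phi q - phi p) + (phi p - phi (a, b)).
    by rewrite addrA subrK.
  by apply: le_lt_trans (opnormD _ _) _; rewrite -ltrBrDr.
have cE := closed_sums_image cD (fun p h => h.1.1).
have nz : ~ [set tsum p.1 p.2 | p in D] z.
  move=> [[a' b'] /= [[/= ha' hb'] hn] ez']; apply: hn.
  by rewrite /phi /= -(Gsum _ _ ha' hb') ez' ez (Gsum _ _ ha hb) subrr opnorm0.
have := near_not_closed cE nz; apply: filterS => y ny [a' [b' [ha' hb' ey]]].
apply: contrapT => hn; apply: ny; exists (a', b'); last exact: esym ey.
split; first exact: (conj ha' hb').
move=> hphi; apply: hn; rewrite ey ez (Gsum _ _ ha' hb') (Gsum _ _ ha hb).
exact: hphi.
Qed.

Lemma conj_dist n (U V A B : 'M[C]_n) :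
  U \is unitarymx -> V \is unitarymx -> opnorm B <= 1 ->
  opnorm (V^t* *m A *m V - U^t* *m B *m U) <= opnorm (A - B) + 2 * opnorm (V - U).
Proof.
move=> hU hV B1.
have -> : V^t* *m A *m V - U^t* *m B *m U =
    V^t* *m (A - B) *m V^t*^t* + ((V - U)^t* *m (B *m V) + U^t* *m (B *m (V - U))).
  have -> : (V - U)^t* = V^t* - U^t* by rewrite linearB /= map_mxB.
  rewrite trmxCK; move: (V^t*) (U^t*) => X Y.
  rewrite !mulmxBr !mulmxBl !mulmxA.
  have tele (a b c d : 'M[C]_n) : a - d = a - b + (b - c + (c - d)).
    by rewrite (addrA (b - c)) subrK addrA subrK.
  exact: tele.
apply: le_trans (opnormD _ _) _; rewrite opnorm_conj ?adj_unitary// lerD2l.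
apply: le_trans (opnormD _ _) _; rewrite mulr_natl mulr2n.
have h1 : opnorm (B *m V) <= 1.
  apply: le_trans (opnormM B V) _.
  exact: le_trans (ler_piMr (opnorm_ge0 B) (opnorm_unitary hV)) B1.
have h2 : opnorm (U^t* *m (B *m (V - U))) <= opnorm (V - U).
  apply: le_trans (opnormM _ _) _.
  apply: le_trans (ler_piMl (opnorm_ge0 _) (opnorm_unitary (adj_unitary hU))) _.
  apply: le_trans (opnormM _ _) _; exact: ler_piMl (opnorm_ge0 _) B1.
apply: lerD h2; apply: le_trans (opnormM _ _) _.
apply: le_trans (ler_piMr (opnorm_ge0 _) h1) _; exact: opnorm_adj.
Qed.

(** The points of dimension [n] whose orbit meets [I]. Compactness of the unitary group keeps this
    set closed and carries continuity from [I] over to it. *)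
Definition saturation n (I : set T) : set T :=
  [set z | tdim z = n /\ exists U : 'M[C]_n, U \is unitarymx /\ I (tact U z)].

Lemma closed_saturation n (I : set T) : closed I -> closed (saturation n I).
Proof.
move=> cI; rewrite -openC; apply: openP => z nZ.
have [hz|nz] := EM (tdim z = n); last first.
  by have := near_not_closed (@closed_tdim R T n) nz; apply: filterS => y ny [].
pose P (U : 'M[C]_n) (y : T) := tdim y = n -> ~ I (tact U y).
suff hP : forall U, U \is unitarymx ->
    \forall V \near U & y \near z, V \is unitarymx -> P V y.
  have := compact_unitary_near hP; apply: filterS => y hy [hy' [U [hU IU]]].
  exact: hy U hU hy' IU.
move=> U hU; apply: (near_tact hU hz (near_not_closed cI _)) => IU.
by apply: nZ; split=> //; exists U.
Qed.

(** By the tube lemma one may work near a fixed [U]. If [tact U z] is outside [I], so are the nearby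
    [tact V y]; otherwise continuity along [I] at [tact U z] is conjugated back by [conj_dist]. *)
Lemma saturation_cont n (I : set T) (G : T -> smx R) z e :
  closed I -> (forall x, conj_at G x) -> (forall x, opnorm (mxof n (G x)) <= 1) ->
  (forall x, I x -> tdim x = n -> forall e, 0 < e -> \forall y \near x, I y ->
    tdim y = n ->
    opnorm (mxof n (G y) - mxof n (G x)) < e) ->
  saturation n I z -> 0 < e ->
  \forall y \near z, saturation n I y ->
    opnorm (mxof n (G y) - mxof n (G z)) < e.
Proof.
move=> cI cG G1 cont [hz _] e0.
have conjG (U : 'M[C]_n) y : U \is unitarymx -> tdim y = n ->
    mxof n (G y) = U^t* *m mxof n (G (tact U y)) *m U.
  move=> hU hy; rewrite (cG y n U hU hy) mxof_Smx !mulmxA (unitary_adjM hU) mul1mx.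
  by rewrite -mulmxA (unitary_adjM hU) mulmx1.
pose P (U : 'M[C]_n) (y : T) := tdim y = n -> I (tact U y) ->
  opnorm (U^t* *m mxof n (G (tact U y)) *m U - mxof n (G z)) < e.
suff hP : forall U, U \is unitarymx ->
    \forall V \near U & y \near z, V \is unitarymx -> P V y.
  have := compact_unitary_near hP; apply: filterS => y hy [hy' [U [hU IU]]].
  by rewrite (conjG U y hU hy'); exact: hy U hU hy' IU.
move=> U hU; have [IU|nI] := EM (I (tact U z)); last first.
  have [[A B] [/= hA hB] hAB] := near_tact hU hz (near_not_closed cI nI).
  by exists (A, B) => //= -[V y] AB hV hy IV; case: (hAB (V, y) AB hV hy IV).
(* [conj_dist] counts the error of the field once and that of the unitary twice: three quarters of
   [e] in all. *)
have e4 : 0 < e / 4 by rewrite divr_gt0.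
have hd := tdim_act hU hz.
have [[A B] [/= hA hB] hAB] := near_tact hU hz (cont _ IU hd _ e4).
have hA' : nbhs U (A `&` [set V | opnorm (V - U) < e / 4]).
  by apply: filterI hA _; apply/nbhs_opnorm; exists (e / 4).
exists (A `&` [set V | opnorm (V - U) < e / 4], B) => //= -[V y] [/= [AV dV] By]
  hV hy IV.
have h1 := hAB (V, y) (conj AV By) hV hy IV (tdim_act hV hy).
rewrite (conjG U z hU hz); apply: le_lt_trans (conj_dist _ hU hV (G1 _)) _.
have quarter (a b : R) : a < e / 4 -> b < e / 4 -> a + 2 * b < e by clear -e0 =>
  *; lra.
exact: (quarter _ _ h1 dV).
Qed.

End Gluing.

(** * Bounded continuous fields with prescribed values *)

Section FieldExistence.
Variables (R : realType) (T : tower R).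
Local Notation C := (Cplx R).
Implicit Types (x y z : T).

Definition snorm (s : smx R) : R := opnorm (projT2 s).

Lemma snorm_mxof n s : projT1 s = n -> opnorm (mxof n s) = snorm s.
Proof. by case: s => m A /= <-; rewrite -/(Smx A) mxof_Smx. Qed.

Lemma opnorm_mxof n (s : smx R) : opnorm (mxof n s) <= snorm s.
Proof.
have [e|ne] := eqVneq (projT1 s) n; first by rewrite snorm_mxof.
by rewrite /mxof nonconform_mx ?ne// opnorm0; exact: opnorm_ge0.
Qed.

Definition zero_field x : smx R := Smx (0 : 'M[C]_(tdim x)).

Lemma zero_field_at n x : tdim x = n -> zero_field x = Smx (0 : 'M[C]_n).
Proof. by move=> <-. Qed.

Lemma zero_field_conj x : conj_at zero_field x.
Proof.
move=> n U hU hx; rewrite (zero_field_at (tdim_act hU hx)) (zero_field_at hx).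
by rewrite mxof_Smx mulmx0 mul0mx.
Qed.

Lemma zero_field_additive : additive_field zero_field.
Proof.
move=> x y; rewrite (zero_field_at (tdim_sum x y)) /zero_field /smx_dsum /=.
by rewrite mxdsum0.
Qed.

Lemma snorm_le1 (G : T -> smx R) : sized G -> (forall x, conj_at G x) ->
  additive_field G -> (forall x, tirreducible x -> snorm (G x) <= 1) ->
  forall x, snorm (G x) <= 1.
Proof.
move=> sG cG aG irr; elim/tower_ind => [x y [U [hU <-]] h|x ix|x y hx hy].
- rewrite (cG x _ U hU erefl); change (opnorm (U *m mxof (tdim x) (G x) *m U^t*)
  <= 1).
  by rewrite opnorm_conj// snorm_mxof.
- exact: irr.
- by rewrite aG; exact: opnorm_dsum.
Qed.

Hypothesis hT : m_tower T.
Variables (S : set T) (x0 : T) (M : 'M[C]_(tdim x0)).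
Hypothesis S_closed : closed S.
Hypothesis S_equiv : forall x y, tequiv x y -> S x -> S y.
Hypothesis S_sum : forall x y, S (tsum x y) -> S x /\ S y.
Hypothesis x0_irr : tirreducible x0.
Hypothesis x0_notin : ~ S x0.
Hypothesis M_norm : opnorm M <= 1.

(** Only continuity is limited to dimensions below [N]; every stage is a complete additive
    equivariant field. *)
Record partial_field (N : nat) (G : T -> smx R) : Prop := PartialField {
  pf_sized : sized G;
  pf_conj : forall x, conj_at G x;
  pf_additive : additive_field G;
  pf_norm : forall x, snorm (G x) <= 1;
  pf_zero : forall x, S x -> G x = zero_field x;
  pf_value : G x0 = Smx M;
  pf_cont : forall n x, (n < N)%N -> tdim x = n -> cont_at G n x
}.

Lemma zero_on_S (G : T -> smx R) : sized G -> (forall x, conj_at G x) ->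
  additive_field G -> (forall x, S x -> tirreducible x -> G x = zero_field x) ->
  forall x, S x -> G x = zero_field x.
Proof.
move=> sG cG aG h.
exact: (@additive_field_eq R T G zero_field S sG (fun=> erefl) cG
  (fun x => @zero_field_conj x) aG
  zero_field_additive S_equiv S_sum h).
Qed.

(** The case of one summand in [mnfold_stab_fixes]: the stabilizer of an irreducible point consists
    of scalars, which fix every value. *)
Lemma mark_inj y (A B : smx R) : mequiv (x0, Smx M) (y, A) ->
  mequiv (x0, Smx M) (y, B) -> A = B.
Proof.
move=> hA hB; have e := mequiv_trans (mequiv_sym hA) hB.
have iy := irreducible_equiv (mequiv_fst hA) x0_irr.
have [_ [_ [_ _ wA _ _]]] := mequivP hA.
have [? [_ _ _ wA' _]] := mequivP hA.
(* An auxiliary field of the right sizes whose value at [y] is [A]; its other values do not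
   matter. *)
pose g x := Smx (mxof (tdim x) A).
have gy : g y = A by rewrite /g Smx_mxof.
have sg : sized g by [].
have := @mnfold_stab_fixes R T hT g sg 1 y erefl iy; rewrite /mnfold /= gy => st.
by have [] := stab_fixes_eq st e erefl.
Qed.

(** The orbit of [x0] receives the conjugates of [M], all other irreducible points receive 0; stage
    0 asks for no continuity. *)
Lemma partial_field0 : exists G, partial_field 0 G.
Proof.
have ex x : exists A : smx R, [/\ projT1 A = tdim x, snorm A <= 1,
    tequiv x0 x -> mequiv (x0, Smx M) (x, A) &
    ~ tequiv x0 x -> A = zero_field x].
  have [[U [hU e]]|ne] := EM (tequiv x0 x); last first.
    by exists (zero_field x); split=> //; rewrite /snorm /= opnorm0.
  exists (Smx (U *m M *m U^t*)); split.
  - by rewrite -e tdim_act.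
  - by rewrite /snorm [projT2 _]/= opnorm_conj.
  - move=> _; split; first exact: erefl.
    by exists U; split; [exact: hU|rewrite /mact e mxof_Smx].
  - by move=> ne; case: ne; exists U.
have [g hg] := choice ex.
have gs : sized g by move=> x; case: (hg x).
have gconj x : tirreducible x -> conj_at g x.
  move=> ix n U hU hx; have hd := tdim_act hU hx.
  have ex' := tequiv_act hU hx.
  have [e|ne] := EM (tequiv x0 x); last first.
    have ne' : ~ tequiv x0 (tact U x).
      by move=> h; apply: ne; exact: tequiv_trans h (tequiv_sym ex').
    have [_ _ _ ->//] := hg (tact U x); have [_ _ _ ->//] := hg x.
    by rewrite (zero_field_conj hU hx).
  have [_ _ /(_ (tequiv_trans e ex')) h1 _] := hg (tact U x).
  have [_ _ /(_ e) h2 _] := hg x.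
  apply: mark_inj h1 _; apply: mequiv_trans h2 _.
  exact: (@mequiv_act _ _ _ U (x, g x) hU hx (gs x)).
have [G [sG cG aG eG]] := irreducible_extension hT gs gconj; exists G; split=> //.
- by apply: snorm_le1 => // x ix; rewrite eG//; case: (hg x).
- apply: zero_on_S => // x Sx ix; rewrite eG//; have [_ _ _ ->//] := hg x.
  by move=> e; apply: x0_notin; exact: S_equiv (tequiv_sym e) Sx.
- rewrite eG//; have [_ _ /(_ (tequiv_refl x0)) h _] := hg x0.
  by apply: mark_inj h _; exact: mequiv_refl.
Qed.

(* Up to the action of the unitary group, the points of dimension n at which the
   value of the field is already prescribed. *)
Definition base_points n : set T :=
  [set z | (exists k : 'I_n, sums k (n - k) z) \/ (S z \/ z = x0)].

Lemma closed_point x : closed [set x].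
Proof.
exact/accessible_closed_set1/hausdorff_accessible/tower_hausdorff.
Qed.

Lemma closed_base_points n : closed (base_points n).
Proof.
rewrite -openC; apply: openP => z nz.
have h1 : \forall y \near z, forall k : 'I_n, ~ sums k (n - k) y.
  apply: filter_forall => k; apply: near_not_closed (@closed_sums R T k (n - k)) _.
  by move=> h; apply: nz; left; exists k.
have h2 : \forall y \near z, ~ S y.
  by apply: near_not_closed S_closed _ => h; apply: nz; right; left.
have h3 : \forall y \near z, y <> x0.
  by apply: near_not_closed (@closed_point x0) _ => h; apply: nz; right; right.
apply: filterS3 h1 h2 h3 => y h1 h2 h3 [[k hk]|[Sy|e]]; first exact: h1 k hk.
  exact: h2.
exact: h3.
Qed.

(** The base set is a finite union of closed pieces, so it is enough to treat separately each piece
    that contains [z]. *)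
Lemma base_points_cont N G z e : partial_field N G -> base_points N z ->
  tdim z = N -> 0 < e -> \forall y \near z, base_points N y -> tdim y = N ->
  opnorm (mxof N (G y) - mxof N (G z)) < e.
Proof.
move=> hG bz hz e0.
have h1 : \forall y \near z, forall k : 'I_N, sums k (N - k) y -> tdim y = N ->
    opnorm (mxof N (G y) - mxof N (G z)) < e.
  apply: filter_forall => k; have [hk|nk] := EM (sums k (N - k) z); last first.
    by apply: filterS (near_not_closed (@closed_sums R T k (N - k)) nk) => y ny /ny.
  have lk := ltn_ord k.
  (* Summands have positive dimension, so [k] and [N - k] are both below [N], where [G] is
     continuous. *)
  have [a [b [ha hb _]]] := hk; have a0 := tdim_gt0 a; rewrite ha in a0.
  have ck x : tdim x = k -> cont_at G k x by apply: (pf_cont hG).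
  have cl x : tdim x = (N - k)%N -> cont_at G (N - k) x.
    by apply: (pf_cont hG); lia.
  have := sums_cont (pf_sized hG) (pf_additive hG) ck cl hk e0.
  rewrite (subnKC (ltnW lk)); apply: filterS => y hy sy _; exact: hy.
have h2 : \forall y \near z, S y -> tdim y = N ->
    opnorm (mxof N (G y) - mxof N (G z)) < e.
  have [Sz|nS] := EM (S z); last first.
    by apply: filterS (near_not_closed S_closed nS) => y ny /ny.
  apply: (@filterS _ _ _ setT); last exact: filterT.
  move=> y _ Sy hy; rewrite (pf_zero hG Sy) (pf_zero hG Sz).
  by rewrite (zero_field_at hy) (zero_field_at hz) subrr opnorm0.
have h3 : \forall y \near z, y = x0 -> tdim y = N ->
    opnorm (mxof N (G y) - mxof N (G z)) < e.
  have [ez|nz] := EM (z = x0); last first.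
    by apply: filterS (near_not_closed (@closed_point x0) nz) => y ny /ny.
  apply: (@filterS _ _ _ setT); last exact: filterT.
  by move=> y _ -> _; rewrite ez subrr opnorm0.
apply: filterS3 h1 h2 h3 => y h1 h2 h3 [[k hk]|[Sy|ey]] hy.
- exact: h1 k hk hy.
- exact: h2.
- exact: h3.
Qed.

(** Dimension [N] is made continuous by [equivariant_extension], and the whole field is regenerated
    from its irreducible values. The two agree in dimension [N] because every reducible point there
    lies in [Z], where nothing was changed. *)
Lemma partial_field_step N G : partial_field N G ->
  exists2 G', partial_field N.+1 G' & forall x, (tdim x < N)%N -> G' x = G x.
Proof.
move=> hG; have sG := pf_sized hG; have cG := pf_conj hG.
have aG := pf_additive hG.
pose Z := saturation N (base_points N).
pose GN x := mxof N (G x).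
have GN1 x : opnorm (GN x) <= 1 := le_trans (opnorm_mxof N (G x)) (pf_norm hG x).
have GNU x (U : 'M[C]_N) : tdim x = N -> U \is unitarymx ->
    GN (tact U x) = U *m GN x *m U^t*.
  by move=> hx hU; rewrite /GN (cG x N U hU hx) mxof_Smx.
have Zdim x : Z x -> tdim x = N by case.
have ZU x (U : 'M[C]_N) : Z x -> U \is unitarymx -> Z (tact U x).
  move=> [hx [V [hV IV]]] hU; split; first exact: tdim_act.
  exists (V *m U^t*); split; first exact: mul_unitarymx hV (adj_unitary hU).
  by rewrite (tactM hV (adj_unitary hU) (tdim_act hU hx)) (tactK hU hx).
have Zcont x : Z x -> mxcvg (within Z (nbhs x)) GN (GN x).
  move=> Zx e e0.
  have hc z : base_points N z -> tdim z = N -> forall d, 0 < d ->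
      \forall y \near z, base_points N y -> tdim y = N ->
      opnorm (mxof N (G y) - mxof N (G z)) < d.
    by move=> bz hz d d0; exact: base_points_cont hG bz hz d0.
  have hs := saturation_cont (@closed_base_points N) cG GN1 hc Zx e0.
  exact: hs.
have [H [cH HU HZ H1]] := equivariant_extension (mtower_sigma hT)
  (closed_saturation (@closed_base_points N)) Zdim ZU
  (fun x U Zx => GNU x U (Zdim x Zx)) Zcont (fun x _ => GN1 x).
(* Not yet additive above dimension [N], where summands of dimension [N] occur; only its irreducible
   values will be kept. *)
pose g x := if tdim x == N then Smx (H x) else G x.
have gN x : tdim x = N -> g x = Smx (H x) by move=> hx; rewrite /g hx eqxx.
have gG x : tdim x <> N -> g x = G x by move=> /eqP/negPf hx; rewrite /g hx.
have sg : sized g.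
  move=> x; have [hx|hx] := EM (tdim x = N); first by rewrite gN.
  by rewrite gG.
have cg x : conj_at g x.
  move=> n U hU hx; have hd := tdim_act hU hx.
  have [e|ne] := EM (n = N); last by rewrite !gG ?hx ?hd// (cG x n U hU hx).
  case: _ / (esym e) in U hU hx hd *; rewrite !gN// mxof_Smx.
  by rewrite (HU x U hx hU).
have [G' [sG' cG' aG' eG']] := irreducible_extension hT sg (fun x _ => cg x).
have GlN x : (tdim x < N)%N -> G' x = G x.
  apply: (additive_field_eq sG' sG cG' cG aG' aG (Q := [set x | (tdim x < N)%N])).
  - by move=> a b /tdim_equiv /= ->.
  - by move=> a b /=; rewrite tdim_sum; lia.
  - by move=> a /= ha ia; rewrite eG'// gG//; lia.
have GeN x : tdim x = N -> G' x = Smx (H x).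
  move=> hx; have [/treducibleP[a [b e]]|ix] := EM (treducible x); last first.
    by rewrite eG'// gN.
  have hab := tdim_equiv e; rewrite tdim_sum hx in hab.
  have a0 := tdim_gt0 a; have b0 := tdim_gt0 b.
  have [U [hU eU]] := e.
  have Zx : Z x.
    split=> //; exists (mxof N (Smx U)); case: _ / hx in hab *.
    rewrite mxof_Smx; split=> //; left; rewrite eU.
    have ak : (tdim a < tdim x)%N by lia.
    exists (Ordinal ak), a, b; split=> //=; lia.
  have eab : G' (tsum a b) = G (tsum a b).
    by rewrite aG' aG !GlN//; lia.
  have ex : G' x = G x.
    have hd := tdim_act (adj_unitary hU) (tdim_act hU erefl).
    rewrite -(tactK hU erefl) eU (cG' _ _ _ (adj_unitary hU)) ?(cG _ _ _
      (adj_unitary hU)) ?eab//.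
      by rewrite -eU tdim_act.
    by rewrite -eU tdim_act.
  by rewrite ex (HZ x Zx) /GN Smx_mxof// sG.
exists G' => //; split=> //.
- apply: snorm_le1 => // x ix; rewrite eG'//.
  have [hx|hx] := EM (tdim x = N); first by rewrite gN//; exact: H1.
  by rewrite gG//; exact: pf_norm hG x.
- apply: zero_on_S => // x Sx ix.
  have [hx|hx] := EM (tdim x = N); last by rewrite eG'// gG//; exact: pf_zero hG
    x Sx.
  have Zx : Z x.
    by split=> //; exists 1%:M; rewrite tact1//; split; [exact:
      unitarymx1|right; left].
  by rewrite GeN// (HZ x Zx) /GN Smx_mxof ?sG// (pf_zero hG Sx).
- have [hx|hx] := EM (tdim x0 = N); last by rewrite eG'// gG//; exact: pf_value hG.
  have Zx : Z x0.
    by split=> //; exists 1%:M; rewrite tact1//; split; [exact: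
      unitarymx1|right; right].
  by rewrite GeN// (HZ x0 Zx) /GN Smx_mxof ?sG// (pf_value hG).
- move=> n x; rewrite ltnS leq_eqVlt => /orP[/eqP-> hx|ltn hx] e e0.
    have ny := near_tdim x; rewrite hx in ny.
    apply: filterS2 ny (cH x hx e e0) => y hy /=.
    by rewrite (GeN y hy) (GeN x hx) !mxof_Smx; exact.
  have ny := near_tdim x; rewrite hx in ny.
  apply: filterS2 ny (pf_cont hG ltn hx e0) => y hy /=.
  have yN : (tdim y < N)%N by rewrite hy.
  have xN : (tdim x < N)%N by rewrite hx.
  by rewrite (GlN y yN) (GlN x xN); exact.
Qed.

Lemma field_exists : exists G, forall N, exists2 G', partial_field N G' &
  forall x, (tdim x < N)%N -> G' x = G x.
Proof.
have next N G : exists G', partial_field N G ->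
    partial_field N.+1 G' /\ forall x, (tdim x < N)%N -> G' x = G x.
  have [/partial_field_step[G' h1 h2]|h] := EM (partial_field N G); first by
    exists G'.
  by exists G.
have [nx hnx] := choice (fun NG : nat * (T -> smx R) => next NG.1 NG.2).
have [G0 hG0] := partial_field0.
pose F := fix F N := if N is N'.+1 then nx (N', F N') else G0.
have FP N : partial_field N (F N).
  by elim: N => [//|N IH]; exact: (hnx (N, F N) IH).1.
have FS N x : (tdim x < N)%N -> F N.+1 x = F N x by exact: (hnx (N, F N) (FP N)).2.
(* The values in dimension [n] are final from stage [n + 1] on. *)
exists (fun x => F (tdim x).+1 x) => N; exists (F N) => // x hx.
have := subnK hx; move: (N - _)%N => k <-; elim: k => [//|k IH].
by rewrite addSn FS// leq_addl.
Qed.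

Theorem field_extension : exists G : T -> smx R,
  [/\ sized G, forall x, conj_at G x, additive_field G & forall x, snorm (G x)
    <= 1] /\
  [/\ forall n x, tdim x = n -> cont_at G n x,
     forall x, S x -> G x = zero_field x & G x0 = Smx M].
Proof.
have [G hG] := field_exists.
have at_ x : exists2 G', partial_field (tdim x).+1 G' &
    forall y, (tdim y <= tdim x)%N -> G' y = G y by exact: hG (tdim x).+1.
exists G; split; split.
- by move=> x; have [G' h e] := at_ x; rewrite -e//; exact: pf_sized h x.
- move=> x n U hU hx; have [G' h e] := at_ x.
  by rewrite -!e ?tdim_act ?hx//; exact: pf_conj h _ _ _ hU hx.
- move=> x y; have [G' h e] := at_ (tsum x y).
  by rewrite -!e ?(pf_additive h)// tdim_sum ?leq_addl ?leq_addr.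
- by move=> x; have [G' h e] := at_ x; rewrite -e//; exact: pf_norm h x.
- move=> n x hx d d0; have [G' h e] := at_ x.
  have hn : (n < (tdim x).+1)%N by rewrite hx.
  apply: filterS2 (near_tdim x) (pf_cont h hn hx d0) => y hy /=.
  have ye : (tdim y <= tdim x)%N by rewrite hy.
  by rewrite (e y ye) (e x (leqnn _)); exact.
- by move=> x Sx; have [G' h e] := at_ x; rewrite -e//; exact: pf_zero h x Sx.
- by have [G' h e] := at_ x0; rewrite -e//; exact: pf_value h.
Qed.

End FieldExistence.

(** * Approximate units *)

Section Decay.
Variables (R : realType) (n : nat).
Local Notation C := (Cplx R).
Variables (gs : seq 'M[C]_n) (c : R).

Definition gram : 'M[C]_n := \sum_(g <- gs) g^t* *m g.

Hypothesis c0 : 0 < c.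
Hypothesis gram_le : opnorm gram <= c.

Let a : 'M[C]_n := rc c^-1 *: gram.
(** The quadratic form of [a], see [hdot_a]. *)
Let q (w : 'cV[C]_n) : R := c^-1 * \sum_(g <- gs) l2norm (g *m w) ^+ 2.

Let q_ge0 w : 0 <= q w.
Proof.
rewrite mulr_ge0 ?invr_ge0 ?(ltW c0)//.
by apply: sumr_ge0 => g _; rewrite exprn_ge0// l2norm_ge0.
Qed.

Lemma gram_adj : gram^t* = gram.
Proof.
rewrite /gram; elim: gs => [|g s IH]; first by rewrite big_nil trmx0 map_mx0.
by rewrite big_cons linearD /= map_mxD IH adjM trmxCK.
Qed.

Lemma hdot_gram w : hdot (gram *m w) w = rc (\sum_(g <- gs) l2norm (g *m w) ^+ 2).
Proof.
rewrite /gram; elim: gs => [|g s IH].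
  by rewrite !big_nil mul0mx /hdot mulmx0 mxE.
rewrite !big_cons mulmxDl hdotDl IH rcD; congr (_ + _).
by rewrite -mulmxA hdot_adjl trmxCK hdot_l2norm.
Qed.

Let conj_rc (r : R) : (rc r)^* = rc r.
Proof. by apply/CrealP; rewrite /rc; apply/complex_realP; exists r. Qed.

Let a_adj : a^t* = a.
Proof.
by rewrite /a linearZ /= map_mxZ gram_adj; congr (_ *: _); exact: conj_rc.
Qed.

Let hdot_a w : hdot (a *m w) w = rc (q w).
Proof. by rewrite /a -scalemxAl hdotZl hdot_gram -rcM. Qed.

Let hdot_herm u w : hdot (a *m u) w = hdot u (a *m w).
Proof. by rewrite hdot_adjl a_adj. Qed.

Let a_norm : opnorm a <= 1.
Proof.
apply: le_trans (opnormZ_le _ _) _; rewrite nc_rc ?invr_ge0 ?(ltW c0)//.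
by rewrite mulrC ler_pdivrMr// mul1r.
Qed.

Let q_le w : q w <= l2norm w ^+ 2.
Proof.
rewrite -(nc_rc (q_ge0 w)) -hdot_a; apply: le_trans (hdot_cauchy _ _) _.
rewrite expr2 ler_wpM2r ?l2norm_ge0//; apply: le_trans (l2norm_mul _ _) _.
exact: ler_piMl (l2norm_ge0 _) a_norm.
Qed.

Let rcB (x y : R) : rc (x - y) = rc x - rc y. Proof. exact: rmorphB. Qed.

Let q_step w :
  q (w - a *m w) = q w - l2norm (a *m w) ^+ 2 - (l2norm (a *m w) ^+ 2 - q (a *m w)).
Proof.
apply: rc_inj; rewrite -hdot_a mulmxBr hdotBl !hdotBr (hdot_herm (a *m w) w).
by rewrite !hdot_a hdot_l2norm !rcB.
Qed.

Let norm_step w :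
  l2norm (w - a *m w) ^+ 2 = l2norm w ^+ 2 - q w - (q w - l2norm (a *m w) ^+ 2).
Proof.
apply: rc_inj; rewrite -hdot_l2norm hdotBl !hdotBr -(hdot_herm w w).
by rewrite !hdot_a !hdot_l2norm !rcB.
Qed.

(** Here [x = q w], [v] is the squared norm of [a *m w] and [u = q (a *m w)]. The inequality
    [v <= x], usually drawn from a square root of [a], follows from [0 <= y], that is from the
    positivity of [q] at [w - a *m w]. *)
Let decay_bounds (x y u v t s : R) : 0 <= y -> 0 <= u -> u <= v ->
  y = x - v - (v - u) -> t = s - x - (x - v) -> y <= x /\ t <= s - x.
Proof. lra. Qed.

Let step_bounds w : q (w - a *m w) <= q w /\
  l2norm (w - a *m w) ^+ 2 <= l2norm w ^+ 2 - q w.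
Proof.
exact: decay_bounds (q_ge0 _) (q_ge0 _) (q_le (a *m w)) (q_step w) (norm_step w).
Qed.

Definition damp (k : nat) : 'M[C]_n := iter k (fun X => X - a *m X) 1%:M.

Let dampS k (w : 'cV[C]_n) : damp k.+1 *m w = damp k *m w - a *m (damp k *m w).
Proof. by rewrite /= mulmxBl mulmxA. Qed.

Let accum (x y s t u : R) (N : R) : 0 <= N -> y <= x -> t <= s - x -> s + N * x
  <= u ->
  t + (1 + N) * y <= u.
Proof.
move=> N0 yx ts h; have : N * y <= N * x by rewrite ler_wpM2l.
lra.
Qed.

(** Each step lowers the squared norm by at least the current [q], and [q] never increases; after
    [k] steps the norm has paid at least [k] times the last [q]. *)
Let damp_bound k (w : 'cV[C]_n) :
  l2norm (damp k *m w) ^+ 2 + k%:R * q (damp k *m w) <= l2norm w ^+ 2.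
Proof.
elim: k => [|k IH]; first by rewrite mul0r addr0 mul1mx.
have [h1 h2] := step_bounds (damp k *m w); rewrite dampS -nat1r.
exact: accum (ler0n _ _) h1 h2 IH.
Qed.

Lemma damp_norm k : opnorm (damp k) <= 1.
Proof.
apply: opnorm_le => // w; rewrite mul1r l2norm_le; apply: le_trans (damp_bound k w).
by rewrite lerDl mulr_ge0.
Qed.

Lemma damp_decay k (e : R) g : 0 < e -> c <= k%:R * e ^+ 2 -> g \in gs ->
  opnorm (g *m damp k) <= e.
Proof.
move=> e0 hk hg; apply: opnorm_le; first exact: ltW.
move=> w; rewrite -mulmxA; set u := damp k *m w.
have k0 : (0 : R) < k%:R.
  by have := lt_le_trans c0 hk; rewrite pmulr_lgt0// exprn_gt0.
have h1 : l2norm (g *m u) ^+ 2 <= c * q u.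
  rewrite /q mulVKf ?gt_eqF//; rewrite (big_rem g hg) /= lerDl.
  by apply: sumr_ge0 => g' _; rewrite exprn_ge0// l2norm_ge0.
have h2 : k%:R * q u <= l2norm w ^+ 2.
  by apply: le_trans (damp_bound k w); rewrite lerDr exprn_ge0// l2norm_ge0.
have h3 : c * q u <= e ^+ 2 * l2norm w ^+ 2.
  apply: le_trans (ler_wpM2r (q_ge0 u) hk) _.
  by rewrite mulrAC mulrC ler_wpM2l// exprn_ge0// ltW.
have := le_trans h1 h3.
by rewrite -exprMn ler_pXn2r// nnegrE ?mulr_ge0 ?l2norm_ge0// ltW.
Qed.

(** [a] commutes with [damp k]. The factor is wanted on the right, next to which the ideal property
    is applied. *)
Lemma dampSr k : damp k.+1 = damp k - damp k *m (rc c^-1 *: gram).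
Proof.
rewrite /damp iterS -/(damp k); congr (_ - _); rewrite -/a.
elim: k => [|k IH]; first by rewrite mulmx1 mul1mx.
change (a *m (damp k - a *m damp k) = (damp k - a *m damp k) *m a).
by rewrite mulmxBr mulmxBl -(mulmxA a (damp k) a) IH.
Qed.

End Decay.

(** * Algebras of fields *)

Section CstarAlgebra.
Variables (R : realType) (T : tower R).
Local Notation C := (Cplx R).
Local Notation nc := (@Normc.normc R).
Implicit Types (x y z : T) (f g : mxfield T).

Definition smx_field f x : smx R := Smx (f x).

(** The sets of constant dimension are open, so continuity within them is continuity on the whole
    tower. *)
Lemma smx_field_cont f : fiber_continuous f <->
  forall n x, tdim x = n -> cont_at (smx_field f) n x.
Proof.
split=> [h n x hx|h n].
  have /subspace_continuousP/(_ x hx) hc := h n.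
  have Fx : Filter (within [set x : T | tdim x = n] (nbhs x)) by exact:
    within_filter.
  move/(@mxcvgP R T _ Fx n) : hc => hc e e0; have ny := near_tdim x; rewrite hx
    in ny.
  by apply: filterS2 ny (hc e e0) => y hy; apply.
apply/subspace_continuousP => x hx.
have Fx : Filter (within [set x : T | tdim x = n] (nbhs x)) by exact: within_filter.
apply/(@mxcvgP R T _ Fx n) => e e0.
by apply: filterS (h n x hx e e0) => y hy _.
Qed.

Lemma smx_field_conj f : fequivariant f <-> forall x, conj_at (smx_field f) x.
Proof.
split=> [h x n U hU hx|h x U hU].
  case: _ / hx in U hU *; rewrite mxof_Smx -(invmx_unitary hU) -(h x U hU).
  by rewrite Smx_conform// tdim_act.
apply: Smx_inj; rewrite Smx_conform ?tdim_act// (invmx_unitary hU).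
by have := h x _ U hU erefl; rewrite mxof_Smx.
Qed.

Lemma smx_field_additive f : fadditive f <-> additive_field (smx_field f).
Proof.
split=> h x y.
  by rewrite /smx_dsum /= -h /smx_field Smx_conform// tdim_sum.
by apply: Smx_inj; rewrite Smx_conform ?tdim_sum//; exact: h.
Qed.

Lemma fbounded_ex f : fbounded f <-> exists c, forall x, opnorm (f x) <= c.
Proof.
split=> -[c hc]; exists c; last by move=> _ [x _ <-]; exact: hc.
by move=> x; apply: hc; exists x.
Qed.

(** Membership in [Cstar] in terms of packed matrices, which are free of [conform_mx]. *)
Record cstar f : Prop := CstarField {
  cstar_cont : forall n x, tdim x = n -> cont_at (smx_field f) n x;
  cstar_conj : forall x, conj_at (smx_field f) x;
  cstar_additive : additive_field (smx_field f);
  cstar_bounded : exists c, forall x, opnorm (f x) <= c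
}.

Lemma CstarP f : Cstar f <-> cstar f.
Proof.
split=> [[/smx_field_cont h1 /smx_field_conj h2 /smx_field_additive h3
  /fbounded_ex h4]|].
  by split.
move=> [h1 h2 h3 h4]; split; first exact/smx_field_cont.
- exact/smx_field_conj.
- exact/smx_field_additive.
- exact/fbounded_ex.
Qed.

Lemma cstar_act f x n (U : 'M[C]_n) : cstar f -> U \is unitarymx -> tdim x = n ->
  mxof n (smx_field f (tact U x)) = U *m mxof n (smx_field f x) *m U^t*.
Proof. by move=> hf hU hx; rewrite (cstar_conj hf hU hx) mxof_Smx. Qed.

Section Pointwise.
Variable op : forall n, 'M[C]_n -> 'M[C]_n -> 'M[C]_n.
Hypothesis op_cont : forall n (f g : T -> 'M[C]_n) x,
  mxcvg (nbhs x) f (f x) -> mxcvg (nbhs x) g (g x) ->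
  mxcvg (nbhs x) (fun y => op (f y) (g y)) (op (f x) (g x)).
Hypothesis op_conj : forall n (U A B : 'M[C]_n), U \is unitarymx ->
  op (U *m A *m U^t*) (U *m B *m U^t*) = U *m op A B *m U^t*.
Hypothesis op_dsum : forall n k (A B : 'M[C]_n) (A' B' : 'M[C]_k),
  op (mxdsum A A') (mxdsum B B') = mxdsum (op A B) (op A' B').
Hypothesis op_bounded : forall a b : R, exists c : R, forall n (A B : 'M[C]_n),
  opnorm A <= a -> opnorm B <= b -> opnorm (op A B) <= c.

Let op_mxof f g n x : tdim x = n ->
  mxof n (smx_field (fun x => op (f x) (g x)) x) =
  op (mxof n (smx_field f x)) (mxof n (smx_field g x)).
Proof. by move=> <-; rewrite !mxof_Smx. Qed.

(** One proof for sum, product, scalar multiple and adjoint; the unary operations ignore their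
    second argument. *)
Lemma cstar_op f g : cstar f -> cstar g -> cstar (fun x => op (f x) (g x)).
Proof.
move=> hf hg; split.
- move=> n x hx e e0; have ny := near_tdim x; rewrite hx in ny.
  apply: filterS2 ny (op_cont (cstar_cont hf hx) (cstar_cont hg hx) e0) => y hy /=.
  by rewrite (op_mxof _ _ hx) (op_mxof _ _ hy); exact.
- move=> x n U hU hx; have hd := tdim_act hU hx.
  rewrite -(Smx_mxof (n := n) (s := smx_field _ (tact U x))) ?hd//.
  by rewrite (op_mxof _ _ hd) (op_mxof _ _ hx) !cstar_act// op_conj.
- move=> x y; have hd := tdim_sum x y.
  rewrite -(Smx_mxof (n := (tdim x + tdim y)%N) (s := smx_field _ (tsum x y)))//.
  rewrite (op_mxof _ _ hd) (cstar_additive hf) (cstar_additive hg).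
  by rewrite /smx_dsum /= !mxof_Smx op_dsum.
- have [a ha] := cstar_bounded hf; have [b hb] := cstar_bounded hg.
  by have [c hc] := op_bounded a b; exists c => x; exact: hc.
Qed.

End Pointwise.

Lemma cstarD f g : cstar f -> cstar g -> cstar (fun x => f x + g x).
Proof.
apply: (@cstar_op (fun n A B => A + B)) => [n f' g' x|n U A B hU|n k A B A' B'|a b].
- exact: mxcvgD.
- by rewrite mulmxDr mulmxDl.
- by rewrite mxdsumD.
- exists (a + b) => n A B hA hB; exact: le_trans (opnormD _ _) (lerD hA hB).
Qed.

Lemma cstarM f g : cstar f -> cstar g -> cstar (fun x => f x *m g x).
Proof.
apply: (@cstar_op (fun n A B => A *m B)) => [n f' g' x|n U A B hU|n k A B A'
  B'|a b].
- exact: mxcvgM.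
- by rewrite !mulmxA -[_ *m U^t* *m U]mulmxA (unitary_adjM hU) mulmx1.
- by rewrite mxdsumM.
- exists (a * b) => n A B hA hB; apply: le_trans (opnormM _ _) _.
  exact: ler_pM (opnorm_ge0 _) (opnorm_ge0 _) hA hB.
Qed.

Lemma cstarZ (c : C) f : cstar f -> cstar (fun x => c *: f x).
Proof.
move=> hf; apply: (@cstar_op (fun n A B => c *: A)) (hf) (hf) => [n f' g' x h
  _|n U A B hU|n k A B A' B'|a b].
- exact: mxcvgZ.
- by rewrite -scalemxAr -scalemxAl.
- by rewrite mxdsumZ.
- exists (nc c * a) => n A B hA hB; apply: le_trans (opnormZ_le _ _) _.
  by rewrite ler_wpM2l ?nc_ge0.
Qed.

Lemma cstar_adj f : cstar f -> cstar (fun x => (f x)^t*).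
Proof.
move=> hf; apply: (@cstar_op (fun n A B => A^t*)) (hf) (hf) => [n f' g' x h _|n
  U A B hU|n k A B A' B'|a b].
- exact: mxcvg_adj.
- by rewrite !adjM trmxCK mulmxA.
- by rewrite mxdsum_adj.
- exists a => n A B hA hB; exact: le_trans (opnorm_adj _) hA.
Qed.

Lemma cstar_zero : cstar (fun x => 0).
Proof.
split.
- move=> n x hx e e0; apply: (@filterS _ _ _ setT); last exact: filterT.
  have h0 y : mxof n (smx_field (fun x : T => 0) y) = 0 :> 'M[C]_n.
    rewrite /mxof /smx_field /=; have [e'|ne] := eqVneq (tdim y) n.
      by case: _ / e'; rewrite conform_mx_id.
    by rewrite nonconform_mx ?ne.
  by move=> y _ /=; rewrite !h0 subrr opnorm0.
- exact: zero_field_conj.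
- exact: zero_field_additive.
- by exists 0 => x; rewrite opnorm0.
Qed.

End CstarAlgebra.

(** * Fields vanishing at infinity *)

Section Cstar0Algebra.
Variables (R : realType) (T : tower R).
Local Notation C := (Cplx R).
Local Notation nc := (@Normc.normc R).
Implicit Types (x y z t : T) (f g b : mxfield T).

Definition decays f := forall e : R, 0 < e ->
  exists K : set T, [/\ compact K, K `<=` core_closure T &
    forall t, (core_closure T `\` K) t -> opnorm (f t) <= e].

Lemma Cstar0P f : Cstar0 f <-> cstar f /\ decays f.
Proof. by split=> -[/CstarP h1 h2]. Qed.

Lemma decays_le f g (k : R) : 0 <= k ->
  (forall x, opnorm (g x) <= k * opnorm (f x)) -> decays f -> decays g.
Proof.
move=> k0 h hf e e0; have k1 : 0 < k + 1 by rewrite ltr_wpDl.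
have [|K [cK KC hK]] := hf (e / (k + 1)); first by rewrite divr_gt0.
exists K; split=> // t /hK ht; apply: le_trans (h t) _.
apply: le_trans (ler_wpM2l k0 ht) _.
by rewrite mulrA ler_pdivrMr// mulrC ler_wpM2l ?(ltW e0)// lerDl.
Qed.

Lemma Cstar0D f g : Cstar0 f -> Cstar0 g -> Cstar0 (fun x => f x + g x).
Proof.
move=> /Cstar0P[cf df] /Cstar0P[cg dg]; apply/Cstar0P; split; first exact: cstarD.
move=> e e0; have e2 : 0 < e / 2 by rewrite divr_gt0.
have [K [cK KC hK]] := df _ e2; have [L [cL LC hL]] := dg _ e2.
exists (K `|` L); split; first exact: compactU.
  by move=> t [/KC|/LC].
move=> t [Ct nKL]; apply: le_trans (opnormD _ _) _; rewrite [leRHS]splitr.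
by apply: lerD; [apply: hK|apply: hL]; split=> // h; apply: nKL; [left|right].
Qed.

Lemma Cstar0Z c f : Cstar0 f -> Cstar0 (fun x => c *: f x).
Proof.
move=> /Cstar0P[cf df]; apply/Cstar0P; split; first exact: cstarZ.
apply: (decays_le (nc_ge0 c) _ df) => x; exact: opnormZ_le.
Qed.

(** [b] need not decay: the fields produced by [bump] are only known to be bounded. *)
Lemma Cstar0Ml b f : cstar b -> Cstar0 f -> Cstar0 (fun x => b x *m f x).
Proof.
move=> cb /Cstar0P[cf df]; apply/Cstar0P; split; first exact: cstarM.
have [k hk] := cstar_bounded cb.
(* A bound over an empty tower may be negative, hence the maximum with 0. *)
apply: (decays_le (k := Num.max 0 k) _ _ df); first by rewrite le_max lexx.
move=> x; apply: le_trans (opnormM _ _) _; apply: ler_wpM2r (opnorm_ge0 _) _ _ _.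
by apply: le_trans (hk x) _; rewrite le_max lexx orbT.
Qed.

Lemma Cstar0Mr b f : cstar b -> Cstar0 f -> Cstar0 (fun x => f x *m b x).
Proof.
move=> cb /Cstar0P[cf df]; apply/Cstar0P; split; first exact: cstarM.
have [k hk] := cstar_bounded cb.
apply: (decays_le (k := Num.max 0 k) _ _ df); first by rewrite le_max lexx.
move=> x; apply: le_trans (opnormM _ _) _; rewrite mulrC.
apply: ler_wpM2r (opnorm_ge0 _) _ _ _.
by apply: le_trans (hk x) _; rewrite le_max lexx orbT.
Qed.

Lemma Cstar0_adj f : Cstar0 f -> Cstar0 (fun x => (f x)^t*).
Proof.
move=> /Cstar0P[cf df]; apply/Cstar0P; split; first exact: cstar_adj.
by apply: (decays_le ler01 _ df) => x; rewrite mul1r; exact: opnorm_adj.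
Qed.

Lemma field_eq_equiv f g x y : cstar f -> cstar g -> tequiv x y ->
  f x = g x -> f y = g y.
Proof.
move=> cf cg [U [hU <-]] e; apply: Smx_inj.
have := cstar_conj cf hU (erefl (tdim x)); have := cstar_conj cg hU (erefl (tdim
  x)).
by rewrite /smx_field !mxof_Smx e => -> ->.
Qed.

Lemma field_eq_sum f g x y : cstar f -> cstar g ->
  f (tsum x y) = g (tsum x y) <-> f x = g x /\ f y = g y.
Proof.
move=> cf cg; have hf := cstar_additive cf x y; have hg := cstar_additive cg x y.
rewrite /smx_field /smx_dsum /= in hf hg; split=> [e|[ex ey]].
  have : Smx (mxdsum (f x) (f y)) = Smx (mxdsum (g x) (g y)) by rewrite -hf -hg e.
  by move=> /Smx_inj/eq_block_mx[].
by apply: Smx_inj; rewrite hf hg ex ey.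
Qed.

(** Multiplicities and the diagonalising unitary are forgotten; what is kept is that the values on
    [s] determine the value at [t]. *)
Lemma components t : exists s : seq T, (forall y, y \in s -> tirreducible y) /\
  forall f g, cstar f -> cstar g -> (forall y, y \in s -> f y = g y) -> f t = g t.
Proof.
elim/tower_ind: t => [x y e [s [si hs]]|x ix|x y [s [si hs]] [s' [si' hs']]].
- exists s; split=> // f g cf cg h.
  exact: field_eq_equiv cf cg e (hs f g cf cg h).
- exists [:: x]; split=> [y|f g _ _ h]; first by rewrite inE => /eqP->.
  by apply: h; rewrite inE.
- exists (s ++ s'); split=> [z|f g cf cg h].
    by rewrite mem_cat => /orP[/si|/si'].
  apply/(field_eq_sum x y cf cg); split.
    by apply: hs => // z zs; apply: h; rewrite mem_cat zs.
  by apply: hs' => // z zs; apply: h; rewrite mem_cat zs orbT.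
Qed.

(** Conjugation preserves the norm and a block sum has the larger of the two norms. Thus decay along
    the core controls a field everywhere. *)
Lemma opnorm_from_irreducible f (c : R) : cstar f ->
  (forall x, tirreducible x -> opnorm (f x) <= c) -> forall x, opnorm (f x) <= c.
Proof.
move=> cf irr; elim/tower_ind => [x y [U [hU <-]] h|//|x y hx hy].
  have := congr1 (@snorm R) (cstar_conj cf hU (erefl (tdim x))).
  rewrite /smx_field mxof_Smx /snorm [projT2 _]/= [projT2 (Smx _)]/= => ->.
  by rewrite opnorm_conj.
have := congr1 (@snorm R) (cstar_additive cf x y).
rewrite /smx_field /smx_dsum /snorm [projT2 _]/= [projT2 (Smx _)]/= => ->.
exact: opnorm_dsum.
Qed.

Lemma near_opnorm_field f x (e : R) : cstar f -> 0 < e ->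
  \forall y \near x, `|opnorm (f y) - opnorm (f x)| < e.
Proof.
move=> cf e0; apply: filterS2 (near_tdim x) (cstar_cont cf (erefl (tdim x)) e0).
move=> y hy /= hlt; apply: le_lt_trans hlt; apply: le_trans (opnorm_dist _ _).
by rewrite !snorm_mxof.
Qed.

Lemma open_opnorm_lt f (e : R) : cstar f -> open [set x | opnorm (f x) < e].
Proof.
move=> cf; apply: openP => x /= hx; have d0 : 0 < e - opnorm (f x) by rewrite
  subr_gt0.
apply: filterS (near_opnorm_field x cf d0) => y.
by rewrite ltr_distl => /andP[_]; rewrite addrCA subrr addr0.
Qed.

Lemma opnorm_eq0 n (A : 'M[C]_n) : opnorm A = 0 -> A = 0.
Proof.
move=> h; apply/matrixP => i j; rewrite [RHS]mxE; apply: Normc.eq0_normc.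
by apply/le_anti; rewrite nc_ge0 andbT -h; exact: opnorm_entry.
Qed.

Lemma closed_zero_set f : cstar f -> closed [set x | f x = 0].
Proof.
move=> cf; rewrite -openC; apply: openP => x /= hx.
have d0 : 0 < opnorm (f x).
  by rewrite lt_def opnorm_ge0 andbT; apply/negP => /eqP/opnorm_eq0.
apply: filterS (near_opnorm_field x cf d0) => y /= hy e.
by move: hy; rewrite e opnorm0 sub0r normrN ger0_norm ?opnorm_ge0// ltxx.
Qed.

(** * Separating fields at irreducible points *)

Section Bump.
Hypothesis hT : m_tower T.

Lemma bump (S : set T) x (M : 'M[C]_(tdim x)) :
  closed S -> (forall y z, tequiv y z -> S y -> S z) ->
  (forall y z, S (tsum y z) -> S y /\ S z) -> tirreducible x -> ~ S x ->
  exists b, [/\ cstar b, b x = M & forall y, S y -> b y = 0].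
Proof.
(* [field_extension] asks for a value of norm at most 1; the extra 1 allows division also when
   [M = 0]. *)
move=> cS eS sS ix nSx; pose k := opnorm M + 1.
have k0 : 0 < k by rewrite ltr_wpDl// opnorm_ge0.
have M1 : opnorm (rc k^-1 *: M) <= 1.
  apply: le_trans (opnormZ_le _ _) _; rewrite nc_rc ?invr_ge0 ?(ltW k0)//.
  by rewrite ler_pdivrMl// mulr1 lerDl.
have [G [[sG cG aG nG] [contG zG vG]]] := field_extension hT cS eS sS ix nSx M1.
pose b0 x : 'M[C]_(tdim x) := mxof (tdim x) (G x).
have eG : smx_field b0 = G by apply/funext => y; rewrite /smx_field /b0 Smx_mxof.
have cb0 : cstar b0.
  split; rewrite ?eG//; exists 1 => y; exact: le_trans (opnorm_mxof _ _) (nG y).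
exists (fun y => rc k *: b0 y); split.
- exact: cstarZ.
- by rewrite /b0 vG mxof_Smx scalerA -rcM mulfV ?gt_eqF// scale1r.
- by move=> y Sy; rewrite /b0 (zG y Sy) mxof_Smx scaler0.
Qed.

(** Here [S] is the orbit of [y]: closed as the saturation of a point, and containing no sums
    because [y] is irreducible. *)
Lemma bump_point x y (M : 'M[C]_(tdim x)) : tirreducible x -> tirreducible y ->
  ~ tequiv y x -> exists b, [/\ cstar b, b x = M & b y = 0].
Proof.
move=> ix iy nyx.
have [|||b [cb bx by0]] := @bump [set z | tequiv y z] x M _ _ _ ix nyx.
- have -> : [set z | tequiv y z] = saturation (tdim y) [set y].
    apply/seteqP; split=> z /=.
      move=> e; split; first exact: tdim_equiv.
      have := tequiv_sym e; rewrite /tequiv (tdim_equiv e) => -[U [hU eU]].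
      by exists U.
    move=> [hz [U [hU eU]]]; apply: tequiv_sym; rewrite -eU.
    exact: tequiv_act.
  exact/closed_saturation/closed_point.
- by move=> a c e e'; exact: tequiv_trans e' e.
- move=> a c e; case: iy; apply/treducibleP; by exists a, c.
by exists b; split=> //; apply: by0; exact: tequiv_refl.
Qed.

Lemma bump_value x (M : 'M[C]_(tdim x)) : tirreducible x ->
  exists b, cstar b /\ b x = M.
Proof.
move=> ix; have [||||b [cb bx _]] := @bump set0 x M _ _ _ ix.
- exact: closed0.
- by [].
- by [].
- by [].
by exists b.
Qed.

Lemma bump_seq x (s : seq T) : tirreducible x ->
  (forall y, y \in s -> tirreducible y /\ ~ tequiv y x) ->
  exists b, [/\ cstar b, b x = 1%:M & forall y, y \in s -> b y = 0].
Proof.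
move=> ix; elim: s => [_|y s IH hs].
  by have [b [cb bx]] := bump_value 1%:M ix; exists b.
have [|b [cb bx b0]] := IH; first by move=> z zs; apply: hs; rewrite inE zs orbT.
have [iy nyx] := hs y (mem_head _ _).
have [b' [cb' bx' b'0]] := bump_point 1%:M ix iy nyx.
exists (fun z => b z *m b' z); split; first exact: cstarM.
  by rewrite bx bx' mulmx1.
move=> z; rewrite inE => /orP[/eqP->|zs]; first by rewrite b'0 mulmx0.
by rewrite b0// mul0mx.
Qed.

End Bump.
End Cstar0Algebra.

(** * Ideals *)

Section Ideals.
Variables (R : realType) (T : tower R).
Local Notation C := (Cplx R).
Local Notation nc := (@Normc.normc R).
Implicit Types (x y z t : T) (f g b : mxfield T).

Lemma adjM_eq0 n (A : 'M[C]_n) : A^t* *m A = 0 -> A = 0.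
Proof.
move=> h; apply: frob_eq0; have := frob_trace A; rewrite h mxtrace0.
by move=> /(@rc_inj R (frob A ^+ 2) 0)/eqP; rewrite sqrf_eq0 => /eqP.
Qed.

(** [adjM_eq0] is used twice. The cube arises because an element of the ideal will be flanked by its
    adjoint on both sides. *)
Lemma cube_neq0 n (A : 'M[C]_n) : A != 0 -> A^t* *m A *m A^t* != 0.
Proof.
apply: contraNneq => h; apply/eqP/adjM_eq0/adjM_eq0.
by rewrite adjM trmxCK mulmxA h mul0mx.
Qed.

(** Matrix units isolate one entry, which is the reason why a full matrix algebra is simple. *)
Lemma delta_mul_delta n (N : 'M[C]_n) (k a a' l : 'I_n) :
  delta_mx k a *m N *m delta_mx a' l = N a a' *: delta_mx k l.
Proof.
rewrite -(mul_delta_mx (0 : 'I_1) k a) -(mul_delta_mx (0 : 'I_1) a' l).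
rewrite -[delta_mx k 0 *m _ *m N]mulmxA -rowE mulmxA -[_ *m _ *m delta_mx a'
  0]mulmxA -colE.
have -> : col a' (row a N) = (N a a')%:M.
  by apply/matrixP => i j; rewrite !mxE !ord1 eqxx.
by rewrite mul_mx_scalar -scalemxAl mul_delta_mx.
Qed.

Lemma fnorm_le f (c : R) : 0 <= c -> (forall x, opnorm (f x) <= c) -> fnorm f <= c.
Proof.
(* On an empty tower [fnorm f] is the supremum of the empty set, which is 0; this case uses [c0]. *)
move=> c0 h; rewrite /fnorm; have [[x _]|ne] := EM (exists x : T, True).
  apply: ge_sup; first by exists (opnorm (f x)), x.
  by move=> _ [y _ <-].
rewrite (_ : image _ _ = set0) ?sup0//.
by rewrite -subset0 => r [x _ _]; apply: ne; exists x.
Qed.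

Lemma finite_open_cover (K : set T) (O : T -> set T) : compact K ->
  (forall t, K t -> nbhs t (O t)) ->
  exists s : seq T, forall x, K x -> exists2 t, t \in s & O t x.
Proof.
move=> /compact_near_coveringP cK hO.
(* The filter of properties that hold for all lists containing a given finite list. *)
pose F : set_system (seq T) :=
  [set P | exists s : seq T, forall s' : seq T, {subset s <= s'} -> P s'].
have FF : Filter F.
  split; first by exists [::].
    move=> P Q [s hs] [s' hs']; exists (s ++ s') => r hr; split.
      by apply: hs => x xs; apply: hr; rewrite mem_cat xs.
    by apply: hs' => x xs; apply: hr; rewrite mem_cat xs orbT.
  by move=> P Q PQ [s hs]; exists s => s' /hs/PQ.
have [|s hs] := cK _ F (fun (s : seq T) x => exists2 t, t \in s & O t x) FF.
  move=> t Kt; exists (O t, [set s : seq T | t \in s]).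
    split; first exact: hO.
    by exists [:: t] => s' hs'; apply: hs'; rewrite inE.
  by move=> [x s] [Ox ts]; exists t.
by exists s => x; exact: hs.
Qed.

Variable J : set (mxfield T).
Hypothesis hJ : closed_ideal J.

Lemma ideal_ext f g : (forall x, f x = g x) -> J f -> J g.
Proof. by move=> /(@boolp.functional_extensionality_dep _ _ f g) ->. Qed.

Lemma ideal_sum I (s : seq I) (F : I -> mxfield T) :
  (forall i, J (F i)) -> J (fun x => \sum_(i <- s) F i x).
Proof.
move=> hF; elim: s => [|i s IH].
  by apply: ideal_ext (ideal0 hJ) => x; rewrite big_nil.
by apply: ideal_ext (idealD hJ (hF i) IH) => x; rewrite big_cons.
Qed.

Lemma ideal_cstar f : J f -> cstar f.
Proof. by move=> /(ideal_sub hJ)/Cstar0P[]. Qed.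

Definition zero_set : set T := [set t | forall f, J f -> f t = 0].

Lemma zero_set_equiv x y : tequiv x y -> zero_set x -> zero_set y.
Proof.
move=> e h f Jf.
exact: (field_eq_equiv (ideal_cstar Jf) (cstar_zero T) e (h f Jf)).
Qed.

Lemma zero_set_sum x y : zero_set (tsum x y) <-> zero_set x /\ zero_set y.
Proof.
have key f : J f -> f (tsum x y) = 0 <-> f x = 0 /\ f y = 0.
  by move=> Jf; exact: (field_eq_sum x y (ideal_cstar Jf) (cstar_zero T)).
split=> [h|[hx hy] f Jf]; last by apply/(key f Jf); split; [exact: hx|exact: hy].
by split=> f Jf; have /(key f Jf)[] := h f Jf.
Qed.

Lemma subtower_zero_set : subtower zero_set.
Proof.
split; last exact: zero_set_sum.
- have -> : zero_set = \bigcap_(f in J) [set x | f x = 0].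
    by apply/seteqP; split=> x h f; exact: h.
  by apply: closed_bigI => f Jf; exact/closed_zero_set/ideal_cstar.
- by move=> x U hx hU; apply: zero_set_equiv hx; exists U.
Qed.

Hypothesis hT : m_tower T.

Lemma ideal_point x (M : 'M[C]_(tdim x)) (s : seq T) : tirreducible x ->
  ~ zero_set x -> (forall y, y \in s -> tirreducible y /\ ~ tequiv y x) ->
  exists e, [/\ J e, e x = M & forall y, y \in s -> e y = 0].
Proof.
move=> ix nzx hs.
have [j [Jj jx]] : exists j, J j /\ j x != 0.
  apply: contrapT => h; apply: nzx => f Jf; apply/eqP; apply: contrapT => /negP hf.
  by apply: h; exists f.
have [beta [cbeta bx b0]] := bump_seq hT ix hs.
pose N : 'M[C]_(tdim x) := (j x)^t* *m j x *m (j x)^t*.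
have [a [a' Na]] : exists a a', N a a' != 0.
  apply: contrapT => h; have := cube_neq0 jx => /negP; apply; apply/eqP/matrixP
    => a a'.
  rewrite [RHS]mxE; apply: contrapT => /eqP hN; apply: h; by exists a, a'.
have [B hB] := choice (fun k => bump_value hT (delta_mx k a : 'M[C]_(tdim x)) ix).
have [B' hB'] := choice (fun k => bump_value hT
  ((N a a')^-1 *: (delta_mx a' k *m M) : 'M[C]_(tdim x)) ix).
have cj := ideal_sub hJ Jj; have cj' := Cstar0_adj cj.
(* The bounded fields are multiplied by the adjoint of [j], so that both factors around the middle
   [j y] lie in C*_0(T). *)
pose F (k : 'I_(tdim x)) : mxfield T := fun y =>
  ((beta y *m B k y) *m (j y)^t* *m j y) *m ((j y)^t* *m B' k y).
have JF k : J (F k).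
  have h1 := Cstar0Ml (cstarM cbeta (hB k).1) cj'.
  have h2 := Cstar0Mr (hB' k).1 cj'.
  exact: (idealMr hJ (idealMl hJ h1 Jj) h2).
exists (fun y => \sum_(k <- enum 'I_(tdim x)) F k y); split.
- exact: ideal_sum.
- rewrite (eq_bigr (fun k => delta_mx k k *m M)) => [|k _].
    by rewrite -mulmx_suml big_enum /= -mx1_sum_delta mul1mx.
  rewrite /F bx mul1mx (hB k).2 (hB' k).2 -!scalemxAr.
  have -> : delta_mx k a *m (j x)^t* *m j x *m ((j x)^t* *m (delta_mx a' k *m M)) =
      delta_mx k a *m N *m delta_mx a' k *m M by rewrite /N !mulmxA.
  by rewrite delta_mul_delta -scalemxAl scalerA mulVf// scale1r.
- move=> y ys; rewrite big1// => k _.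
  by rewrite /F (b0 y ys) !mul0mx.
Qed.

(** As in Newton interpolation, each new point gets a correction that vanishes at the earlier ones.
    A point equivalent to an earlier one, or lying in the zero set, needs no correction. *)
Lemma ideal_interpolation f (s : seq T) : Cstar0 f ->
  (forall t, zero_set t -> f t = 0) -> (forall y, y \in s -> tirreducible y) ->
  exists g, J g /\ forall y, y \in s -> g y = f y.
Proof.
move=> /Cstar0P[cf _] f0; elim: s => [_|y s IH hs].
  by exists (fun x => 0); split=> //; exact: (ideal0 hJ).
have [|g [Jg gs]] := IH; first by move=> z zs; apply: hs; rewrite inE zs orbT.
have iy := hs y (mem_head _ _).
have cg := ideal_cstar Jg.
have [[z [zs ezy]]|nz] := EM (exists z, z \in s /\ tequiv z y).
  exists g; split=> // t; rewrite inE => /orP[/eqP->|/gs//].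
  exact: (field_eq_equiv cg cf ezy (gs z zs)).
have [zy|nzy] := EM (zero_set y).
  exists g; split=> // t; rewrite inE => /orP[/eqP->|/gs//].
  by rewrite (f0 y zy) (zy g Jg).
have [|e [Je ey es]] := ideal_point (f y - g y) iy nzy (s := s).
  move=> z zs; split; first by apply: hs; rewrite inE zs orbT.
  by move=> ezy; apply: nz; exists z.
exists (fun x => g x + e x); split; first exact: (idealD hJ Jg Je).
move=> t; rewrite inE => /orP[/eqP->|ts]; first by rewrite ey addrC subrK.
by rewrite (es t ts) addr0 gs.
Qed.

Lemma ideal_pointwise f t : Cstar0 f -> (forall t, zero_set t -> f t = 0) ->
  exists g, J g /\ g t = f t.
Proof.
move=> Cf f0; have [s [si hs]] := components t.
have [g [Jg gs]] := ideal_interpolation Cf f0 si.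
by exists g; split=> //; apply: hs => //; [exact: ideal_cstar|have /Cstar0P[] :=
  Cf].
Qed.

Let quarter_sum (e : R) : 0 < e -> e / 4 * 1 + e / 4 < e.
Proof. lra. Qed.

Lemma ideal_approximation f (e : R) : Cstar0 f ->
  (forall t, zero_set t -> f t = 0) -> 0 < e ->
  exists2 g, J g & fnorm (fun x => f x - g x) < e.
Proof.
move=> Cf f0 e0; have /Cstar0P[cf df] := Cf.
(* Two errors of size [d] add up to [e / 2], strictly below [e]. *)
pose d := e / 4; have d0 : 0 < d by rewrite divr_gt0.
have [K [cK KC hK]] := df d d0.
have [G hG] := choice (fun t => ideal_pointwise t Cf f0).
pose diff t : mxfield T := fun x => f x + (-1) *: G t x.
have cdiff t : cstar (diff t).
  exact: cstarD cf (cstarZ _ (ideal_cstar (hG t).1)).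
pose O t := [set y | opnorm (diff t y) < d].
have nO t : K t -> nbhs t (O t).
  move=> _; apply: open_nbhs_nbhs; split; first exact: open_opnorm_lt.
  by rewrite /O /= /diff (hG t).2 scaleN1r subrr opnorm0; exact: d0.
have [D KD] := finite_open_cover cK nO.
pose gs x : seq 'M[C]_(tdim x) := [seq G t x | t <- D].
pose h : mxfield T := fun x => gram (gs x).
have Jh : J h.
  apply: (ideal_ext (f := fun x => \sum_(t <- D) ((G t x)^t* *m G t x))).
    by move=> x; rewrite /h /gram big_map.
  apply: ideal_sum => t; apply: (idealMl hJ _ (hG t).1).
  exact: Cstar0_adj (ideal_sub hJ (hG t).1).
have [k hk] := cstar_bounded (ideal_cstar Jh).
pose c := Num.max 1 k; have c0 : 0 < c by rewrite lt_max ltr01.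
have hc x : opnorm (gram (gs x)) <= c by apply: le_trans (hk x) _; rewrite
  le_max lexx orbT.
pose w m : mxfield T := fun x => f x *m damp (gs x) c m.
(* Passing to [m + 1] adds [w m] times [a], where [w m] is in C*_0(T) as the difference of [f] and
   an element of [J]. *)
have Jw m : J (fun x => f x - w m x).
  elim: m => [|m IH].
    by apply: ideal_ext (ideal0 hJ) => x; rewrite /w mulmx1 subrr.
  have Cw : Cstar0 (w m).
    have := Cstar0D Cf (Cstar0Z (-1) (ideal_sub hJ IH)).
    congr Cstar0; apply: boolp.functional_extensionality_dep => x.
    by rewrite scaleN1r opprB addrC subrK.
  have := idealD hJ IH (idealMl hJ Cw (idealZ hJ (rc c^-1) Jh)).
  apply: ideal_ext => x; rewrite /w dampSr mulmxBr mulmxA.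
  have tele (u v z : 'M[C]_(tdim x)) : u - v + z = u - (v - z).
    by rewrite opprB [RHS]addrA addrAC.
  exact: tele.
have [m hm] : exists m : nat, c <= m%:R * d ^+ 2.
  exists (Num.Def.archi_bound (c / d ^+ 2)).
  rewrite -ler_pdivrMr ?exprn_gt0//; apply/ltW/archi_boundP.
  by rewrite divr_ge0 ?exprn_ge0// ltW.
exists (fun x => f x - w m x) => //.
have d1 : d * 1 + d < e := quarter_sum e0.
have dd0 : 0 <= d * 1 + d by rewrite mulr1 addr_ge0// ltW.
apply: le_lt_trans d1; apply: (fnorm_le dd0).
suff hw : forall x, opnorm (w m x) <= d * 1 + d.
  move=> x; have -> : f x - (f x - w m x) = w m x by rewrite opprB addrCA subrr
    addr0.
  exact: hw.
have Cw : cstar (w m).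
  have := cstarD cf (cstarZ (-1) (ideal_cstar (Jw m))).
  congr cstar; apply: boolp.functional_extensionality_dep => x.
  by rewrite scaleN1r opprB addrC subrK.
(* On [K] some [G t] is within [d] of [f] and is damped to norm at most [d]; off [K] the field [f]
   is itself at most [d], and [damp] is a contraction. *)
apply: (opnorm_from_irreducible Cw) => x ix.
have [Kx|nKx] := EM (K x).
  have [t tD Ot] := KD x Kx.
  have -> : w m x = diff t x *m damp (gs x) c m + G t x *m damp (gs x) c m.
    by rewrite -mulmxDl /diff scaleN1r subrK.
  apply: le_trans (opnormD _ _) _; apply: lerD.
    apply: le_trans (opnormM _ _) _; apply: ler_pM (opnorm_ge0 _) (opnorm_ge0 _)
      _ _.
      exact: ltW.
    exact: damp_norm.
  apply: (damp_decay c0 (hc x) d0 hm).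
  by apply/mapP; exists t.
have hx : opnorm (f x) <= d.
  by apply: hK; split=> //; exact: subset_closure.
apply: le_trans (opnormM _ _) _.
apply: le_trans (ler_pM (opnorm_ge0 _) (opnorm_ge0 _) hx (damp_norm c0 (hc x) m)) _.
by rewrite lerDl ltW.
Qed.

Lemma ideal_of_zero_set : J = ideal_of zero_set.
Proof.
apply/seteqP; split=> [f Jf|f [Cf f0]].
  by split; [exact: ideal_sub hJ f Jf|move=> x; exact].
apply: (ideal_closed hJ Cf) => e e0; exact: ideal_approximation.
Qed.

(** At an irreducible zero [x] of [J] outside [S], the inclusion of the vanishing tower in [S]
    provides [f] with [f x <> 0]. Multiplied by a field that is 1 at [x] and 0 on [S], it falls into
    [J] without vanishing at [x]. *)
Lemma zero_set_min (S : set T) : subtower S -> vanishing_tower T `<=` S ->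
  J = ideal_of S -> zero_set `<=` S.
Proof.
move=> [cS actS sumS] vS eJ.
have eS y z : tequiv y z -> S y -> S z by move=> [U [hU <-]] Sy; exact: actS.
elim/tower_ind => [x y e IH zy|x ix zx|x y IHx IHy /zero_set_sum[/IHx Sx /IHy Sy]].
- by apply: (eS x) => //; apply: IH; exact: zero_set_equiv (tequiv_sym e) zy.
- apply: contrapT => nSx.
  have [f [Cf fx]] : exists f, Cstar0 f /\ f x <> 0.
    apply: contrapT => h; apply: nSx; apply: vS => f Cf.
    by apply: contrapT => fx; apply: h; exists f.
  have [b [cb bx b0]] := bump hT 1%:M cS eS (fun y z => (sumS y z).1) ix nSx.
  have Jbf : J (fun y => b y *m f y).
    rewrite eJ; split; first exact: Cstar0Ml.
    by move=> y Sy; rewrite (b0 y Sy) mul0mx.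
  by apply: fx; have := zx _ Jbf; rewrite bx mul1mx.
- by apply/sumS.
Qed.

End Ideals.

Theorem corollary4p8 (R : realType) (T : tower R) (hT : m_tower T)
    (hlc : essentially_locally_compact T)
    (J : set (mxfield T)) (hJ : closed_ideal J) :
  exists! S : set T,
    [/\ subtower S, vanishing_tower T `<=` S & J = ideal_of S].
Proof.
exists (zero_set J); split.
  split; [exact: subtower_zero_set| |exact: ideal_of_zero_set].
  by move=> t ht f Jf; exact: ht (ideal_sub hJ Jf).
move=> S [hS vS eS]; apply/seteqP; split; first exact: zero_set_min.
by move=> x Sx f; rewrite eS => -[_]; exact.
Qed.
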